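(* Let $d_1,d_2,d_3\in\mathbb Z$ with $d_1+d_3\ge d_2$ and let $V$ be a simple $\widehat{\mathfrak{age}}(1)_{(d_1,d_2,d_3)}$-module. Suppose there exists an integer $l>d_2$ such that (a) $p_l$ acts injectively on $V$; (b) $p_{l+i}V=z_{l+d_2-d_1+i-1}V=e_{l-d_3+i}V=q_{l-d_1+i}V=h_{l-d_2+i}V=0$ for all integers $i>0$ (where it is understood that these elements belong to $\widehat{\mathfrak{age}}(1)_{(d_1,d_2,d_3)}$, i.e. $l+1\ge d_1+d_3$). Then the induced module $\mathrm{Ind}_{\widehat{\mathfrak{age}}(1)_{(d_1,d_2,d_3)}}^{\widehat{\mathfrak{age}}(1)}(V)$ is a simple restricted $\widehat{\mathfrak{age}}(1)$-module.
   Context: All vector spaces are over $\mathbb C$; $\mathbb N$ denotes the nonnegative integers. The 1-spatial ageing algebra $\mathfrak{age}(1)$ is the complex Lie algebra with basis $\{e,h,p,q,z\}$ and brackets $[h,e]=2e$, $[h,p]=p$, $[h,q]=-q$, $[e,p]=0$, $[e,q]=p$, $[p,q]=z$, $[z,\mathfrak{age}(1)]=0$. The affine ageing algebra is $\widehat{\mathfrak{age}}(1)=\mathfrak{age}(1)\otimes\mathbb C[t,t^{-1}]\oplus\mathbb Ck$ with $[\alpha\otimes t^m,\beta\otimes t^n]=[\alpha,\beta]\otimes t^{m+n}+m(\alpha\mid\beta)\delta_{m+n,0}k$ and $k$ central, where $(\cdot\mid\cdot)$ is the symmetric bilinear form with $(h\mid h)=1$ and all other pairings of basis elements zero. Write $\alpha_n=\alpha\otimes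 t^n$; $\alpha_0$ is also written $\alpha$. For $d_1,d_2,d_3\in\mathbb Z$ with $d_1+d_3\ge d_2$, the subalgebra $\widehat{\mathfrak{age}}(1)_{(d_1,d_2,d_3)}$ is $\sum_{i\in\mathbb N}(\mathbb Ch_i\oplus\mathbb Ce_{d_1+i}\oplus\mathbb Cp_{d_2+i}\oplus\mathbb Cq_{d_3+i})\oplus\sum_{i\in\mathbb Z}\mathbb Cz_i\oplus\mathbb Ck$. For a module $V$ over it, $\mathrm{Ind}_{\widehat{\mathfrak{age}}(1)_{(d_1,d_2,d_3)}}^{\widehat{\mathfrak{age}}(1)}(V)=U(\widehat{\mathfrak{age}}(1))\otimes_{U(\widehat{\mathfrak{age}}(1)_{(d_1,d_2,d_3)})}V$. An $\widehat{\mathfrak{age}}(1)$-module $W$ is called restricted if for every $w\in W$ one has $e_mw=p_mw=q_mw=h_mw=z_mw=0$ for all sufficiently large $m$. *)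

(* Defs.v *)
From HB Require Import structures.
From mathcomp Require Import all_boot all_order all_algebra.
From mathcomp Require Import finmap.
From mathcomp Require Import boolp reals complex monalg.

Set Implicit Arguments.
Unset Strict Implicit.
Unset Printing Implicit Defensive.

Import Order.TTheory GRing.Theory Num.Theory.
Local Open Scope ring_scope.
Local Open Scope quotient_scope.

Section FreeModule.
Variables (K : fieldType) (B : choiceType).
Local Notation M := {malg K[B]}.

(* This is {malg K[B]} with all operations locked: unification is unusably
   slow when it can unfold them. *)
Definition freemod : Type := M.

HB.instance Definition _ := Choice.on freemod.

Fact freemod_key : unit. Proof. exact: tt. Qed.

Definition fm_zero : freemod := locked_with freemod_key (0 : M).
Definition fm_opp : freemod -> freemod :=
  locked_with freemod_key (fun u : M => - u).
Definition fm_add : freemod -> freemod -> freemod :=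
  locked_with freemod_key (fun u v : M => u + v).
Definition fm_scale : K -> freemod -> freemod :=
  locked_with freemod_key (fun c (u : M) => c *: u).

Definition fbasis : B -> freemod :=
  locked_with freemod_key (fun b => << b >> : M).
Definition fcoef : B -> freemod -> K :=
  locked_with freemod_key (fun b (u : M) => u@_b).

Definition lext : forall V : lmodType K, (B -> V) -> freemod -> V :=
  locked_with freemod_key (fun (V : lmodType K) (f : B -> V) (u : M) =>
    \sum_(b <- msupp u) u@_b *: f b).

Lemma fm_zeroE : fm_zero = 0 :> M. Proof. by rewrite /fm_zero unlock. Qed.
Lemma fm_oppE (u : M) : fm_opp u = - u :> M.
Proof. by rewrite /fm_opp unlock. Qed.
Lemma fm_addE (u v : M) : fm_add u v = u + v :> M.
Proof. by rewrite /fm_add unlock. Qed.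
Lemma fm_scaleE c (u : M) : fm_scale c u = c *: u :> M.
Proof. by rewrite /fm_scale unlock. Qed.
Lemma fbasisE b : fbasis b = << b >> :> M.
Proof. by rewrite /fbasis unlock. Qed.
Lemma fcoefE b (u : M) : fcoef b u = u@_b.
Proof. by rewrite /fcoef unlock. Qed.
Lemma lextE (V : lmodType K) (f : B -> V) (u : M) :
  lext f u = \sum_(b <- msupp u) u@_b *: f b.
Proof. by rewrite /lext unlock. Qed.

Lemma fm_addA : associative fm_add.
Proof. by move=> u v w; rewrite !fm_addE addrA. Qed.

Lemma fm_addC : commutative fm_add.
Proof. by move=> u v; rewrite !fm_addE addrC. Qed.

Lemma fm_add0 : left_id fm_zero fm_add.
Proof. by move=> u; rewrite fm_addE fm_zeroE add0r. Qed.

Lemma fm_addN : left_inverse fm_zero fm_opp fm_add.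
Proof. by move=> u; rewrite fm_addE fm_oppE fm_zeroE addNr. Qed.

HB.instance Definition _ := GRing.isZmodule.Build freemod
  fm_addA fm_addC fm_add0 fm_addN.

Lemma fm_scaleA a b u : fm_scale a (fm_scale b u) = fm_scale (a * b) u.
Proof. by rewrite !fm_scaleE scalerA. Qed.

Lemma fm_scale1 : left_id 1 fm_scale.
Proof. by move=> u; rewrite fm_scaleE scale1r. Qed.

Lemma fm_scaleDr : right_distributive fm_scale fm_add.
Proof. by move=> c u v; rewrite !(fm_scaleE, fm_addE) scalerDr. Qed.

Lemma fm_scaleDl u : {morph fm_scale^~ u : a b / a + b >-> fm_add a b}.
Proof. by move=> a b; rewrite !(fm_scaleE, fm_addE) scalerDl. Qed.

HB.instance Definition _ := GRing.Zmodule_isLmodule.Build K freemod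
  fm_scaleA fm_scale1 fm_scaleDr fm_scaleDl.

Lemma fcoef_is_linear b : scalar (fcoef b).
Proof.
move=> c u v; rewrite -[c *: u + v]/(fm_add (fm_scale c u) v).
by rewrite fm_addE fm_scaleE !fcoefE mcoeffD mcoeffZ.
Qed.

HB.instance Definition _ b :=
  GRing.isLinear.Build K freemod K *%R (fcoef b) (fcoef_is_linear b).

Lemma fcoef_basis b b' : fcoef b (fbasis b') = (b' == b)%:R.
Proof. by rewrite fbasisE fcoefE mcoeffU. Qed.

Lemma freemodP (u v : freemod) : (forall b, fcoef b u = fcoef b v) -> u = v.
Proof. by move=> uv; apply/malgP => b; rewrite -!fcoefE. Qed.

Lemma freemod_ind (P : freemod -> Prop) :
  P 0 -> (forall c b u, P u -> P (c *: fbasis b + u)) -> forall u, P u.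
Proof.
move=> P0 PD u.
have {P0} : P (0 : M) by rewrite -fm_zeroE.
rewrite [u]monalgE; elim/big_rec: _ => // b w _ IH /IH{IH} /(PD (u : M)@_b b).
suff -> : (u : M)@_b *: fbasis b + w = << (u : M)@_b *g b >> + (w : M) :> M by [].
rewrite -[LHS]/(fm_add (fm_scale _ _) _) fm_addE fm_scaleE fbasisE.
congr (_ + _); apply/malgP=> k; rewrite mcoeffZ !mcoeffU.
by rewrite mulr_natr.
Qed.

Section Lext.
Variables (V : lmodType K) (f : B -> V).

Lemma lextEw (u : M) (d : {fset B}) : (msupp u `<=` d)%fset ->
  lext f u = \sum_(b <- d) u@_b *: f b.
Proof.
move=> le; rewrite lextE [LHS](big_fset_incl _ le) => //= x xd /mcoeff_outdom ->.
by rewrite scale0r.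
Qed.

Lemma lext_basis b : lext f (fbasis b) = f b.
Proof. by rewrite fbasisE (lextEw msuppU_le) big_seq_fset1 mcoeffUU scale1r. Qed.

Lemma lext_is_linear : linear (lext f).
Proof.
move=> a u v; rewrite -[a *: u + v]/(fm_add (fm_scale a u) v).
rewrite fm_addE fm_scaleE.
rewrite (@lextEw _ (msupp (u : M) `|` msupp (v : M))%fset); last first.
  apply: fsubset_trans (msuppD_le _ _) _.
  by apply: fsetSU; exact: msuppZ_le.
rewrite (@lextEw u (msupp (u : M) `|` msupp (v : M))%fset) ?fsubsetUl //.
rewrite (@lextEw v (msupp (u : M) `|` msupp (v : M))%fset) ?fsubsetUr //.
rewrite scaler_sumr -big_split /=; apply: eq_bigr => b _.
by rewrite mcoeffD mcoeffZ scalerDl scalerA.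
Qed.

HB.instance Definition _ :=
  GRing.isLinear.Build K freemod V *:%R (lext f) lext_is_linear.

End Lext.

Lemma lext_linear_fun (V : lmodType K) (f g : B -> V) c u :
  lext (fun b => c *: f b + g b) u = c *: lext f u + lext g u.
Proof.
elim/freemod_ind: u => [|d b u IH]; first by rewrite !linear0 addr0.
rewrite !linearP /= IH !lext_basis !scalerDr !scalerA [d * c]mulrC.
by rewrite addrACA.
Qed.

End FreeModule.

Arguments fbasis {K B} b.

Section BilinearExtension.
Variables (K : fieldType) (B C : choiceType) (V : lmodType K) (br : B -> C -> V).

Definition lext2 (u : freemod K B) (v : freemod K C) : V :=
  lext (fun a => lext (br a) v) u.

Lemma lext2_basis a b : lext2 (fbasis a) (fbasis b) = br a b.
Proof. by rewrite /lext2 !lext_basis. Qed.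

Lemma lext2_linearl v : linear (lext2^~ v).
Proof. exact: lext_is_linear. Qed.

Lemma lext2_linearr u : linear (lext2 u).
Proof.
move=> c v v'; rewrite /lext2 -lext_linear_fun; congr (lext _ u).
by apply/funext => a; rewrite linearP.
Qed.

End BilinearExtension.

Lemma linear_0 (K : fieldType) (U V : lmodType K) (f : U -> V) :
  linear f -> f 0 = 0.
Proof. by move=> /(_ (-1) 0 0); rewrite scaler0 addr0 scaleN1r addNr. Qed.

Section LinearQuotient.
Variables (K : fieldType) (V : lmodType K) (I : submodClosed V).

Definition lquot_pred : {pred V} := fun v => v \in I.

Lemma lquot_pred_closed : zmod_closed lquot_pred.
Proof.
split=> [|u v uI vI]; first exact: (rpred0 I).
have vI' : v \in I by []; have uI' : u \in I by [].
suff : u - v \in I by [].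
by rewrite -scaleN1r; apply: (rpredD uI'); apply: rpredZ.
Qed.

HB.instance Definition _ := GRing.isZmodClosed.Build V lquot_pred
  lquot_pred_closed.

Local Notation Q := (Quotient.quot lquot_pred).

Definition lquot : Type := Q.

HB.instance Definition _ := GRing.Zmodule.on lquot.

Definition lpi (v : V) : lquot := \pi_(Q) v.

Definition lrepr (x : lquot) : V := repr (x : Q).

Lemma lreprK : cancel lrepr lpi.
Proof. by move=> x; rewrite /lpi /lrepr reprK. Qed.

Lemma lpi_surj (x : lquot) : exists v, x = lpi v.
Proof. by exists (lrepr x); rewrite lreprK. Qed.

Lemma lpi_eq (u v : V) : lpi u = lpi v <-> u - v \in I.
Proof.
rewrite -[u - v \in I]/(u - v \in lquot_pred) Quotient.idealrBE.
by split=> [/eqP|/eqP].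
Qed.

Lemma lpiD u v : lpi (u + v) = lpi u + lpi v.
Proof. exact: Quotient.pi_add. Qed.

Lemma lrepr_lpi v : lrepr (lpi v) - v \in I.
Proof. by apply/lpi_eq; rewrite lreprK. Qed.

Definition lquot_scale (a : K) (x : lquot) : lquot :=
  lpi (a *: lrepr x).

Lemma lquot_scaleE a v : lquot_scale a (lpi v) = lpi (a *: v).
Proof. by apply/lpi_eq; rewrite -scalerBr rpredZ // lrepr_lpi. Qed.

Lemma lquot_scaleA a b x :
  lquot_scale a (lquot_scale b x) = lquot_scale (a * b) x.
Proof. by have [v ->] := lpi_surj x; rewrite !lquot_scaleE scalerA. Qed.

Lemma lquot_scale1 : left_id 1 lquot_scale.
Proof. by move=> x; have [v ->] := lpi_surj x; rewrite lquot_scaleE scale1r. Qed.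

Lemma lquot_scaleDr : right_distributive lquot_scale +%R.
Proof.
move=> a x y; have [u ->] := lpi_surj x; have [v ->] := lpi_surj y.
by rewrite -lpiD !lquot_scaleE -lpiD scalerDr.
Qed.

Lemma lquot_scaleDl x : {morph lquot_scale^~ x : a b / a + b}.
Proof.
by move=> a b; have [v ->] := lpi_surj x; rewrite !lquot_scaleE -lpiD scalerDl.
Qed.

HB.instance Definition _ := GRing.Zmodule_isLmodule.Build K lquot
  lquot_scaleA lquot_scale1 lquot_scaleDr lquot_scaleDl.

Lemma lpi_is_linear : linear lpi.
Proof. by move=> a u v; rewrite lpiD -lquot_scaleE. Qed.

HB.instance Definition _ :=
  GRing.isLinear.Build K V lquot *:%R lpi lpi_is_linear.

Definition lquot_lift (W : Type) (f : V -> W) (x : lquot) : W :=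
  f (lrepr x).

Lemma lquot_liftE (W : lmodType K) (f : {linear V -> W}) v :
  (forall w, w \in I -> f w = 0) -> lquot_lift f (lpi v) = f v.
Proof.
move=> fI; apply/eqP; rewrite -subr_eq0 /lquot_lift -linearB /=.
by rewrite fI // lrepr_lpi.
Qed.

End LinearQuotient.

Section Span.
Variables (K : fieldType) (V : lmodType K) (S : V -> Prop).

Definition is_subspace (W : V -> Prop) : Prop :=
  W 0 /\ forall a u v, W u -> W v -> W (a *: u + v).

Definition lspan : {pred V} := fun v =>
  `[< forall W, is_subspace W -> (forall s, S s -> W s) -> W v >].

Lemma lspanP v :
  v \in lspan <-> forall W, is_subspace W -> (forall s, S s -> W s) -> W v.
Proof. by rewrite unfold_in; split => /asboolP. Qed.

Lemma lspan_closed : submod_closed lspan.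
Proof.
split; first by apply/lspanP => W [].
move=> a u v /lspanP Su /lspanP Sv; apply/lspanP => W sW SW.
by apply: sW.2; [exact: Su|exact: Sv].
Qed.

HB.instance Definition _ := GRing.isSubmodClosed.Build K V lspan lspan_closed.

Lemma mem_lspan s : S s -> s \in lspan.
Proof. by move=> Ss; apply/lspanP => W _; apply. Qed.

Lemma lspan_ker (W : lmodType K) (f : {linear V -> W}) :
  (forall s, S s -> f s = 0) -> forall v, v \in lspan -> f v = 0.
Proof.
move=> fS v /lspanP/(_ (fun w => f w = 0)); apply => //.
split; first exact: linear0.
by move=> a u w fu fw; rewrite linearP fu fw scaler0 addr0.
Qed.

End Span.

HB.mixin Record Lmodule_isLieAlgebra (K : fieldType) L of GRing.Lmodule K L := {
  lie : L -> L -> L;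
  lie_linearl : forall y, linear (lie^~ y);
  lie_linearr : forall x, linear (lie x);
  liexx : forall x, lie x x = 0;
  lie_jacobi : forall x y z, lie x (lie y z) = lie (lie x y) z + lie y (lie x z)
}.

#[short(type="lieAlgType")]
HB.structure Definition LieAlgebra (K : fieldType) :=
  { L of GRing.Lmodule K L & Lmodule_isLieAlgebra K L }.

HB.mixin Record Lmodule_isLieModule (K : fieldType) (L : lieAlgType K) V
    of GRing.Lmodule K V := {
  lact : L -> V -> V;
  lact_linearl : forall v, linear (lact^~ v);
  lact_linearr : forall x, linear (lact x);
  lact_lie : forall x y v,
    lact (lie x y) v = lact x (lact y v) - lact y (lact x v)
}.

#[short(type="lieModType")]
HB.structure Definition LieModule (K : fieldType) (L : lieAlgType K) :=
  { V of GRing.Lmodule K V & Lmodule_isLieModule K L V }.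

Section LieModuleTheory.
Variables (K : fieldType) (L : lieAlgType K) (V : lieModType L).

HB.instance Definition _ (x : L) :=
  GRing.isLinear.Build K V V *:%R (lact x) (lact_linearr x).

Definition is_submodule (W : V -> Prop) : Prop :=
  is_subspace W /\ forall (x : L) v, W v -> W (lact x v).

Definition simple_module : Prop :=
  (exists v : V, v <> 0) /\
  forall W, is_submodule W -> (forall v, W v -> v = 0) \/ (forall v, W v).

End LieModuleTheory.

Section LieSubalgebra.
Variables (K : fieldType) (L : lieAlgType K) (S : submodClosed L).

Definition lie_closed : Prop :=
  forall x y, x \in S -> y \in S -> lie x y \in S.

Definition subalg (S_lie : lie_closed) : Type := {x : L | x \in S}.

Variable S_lie : lie_closed.
Local Notation H := (subalg S_lie).

HB.instance Definition _ := SubChoice.on H.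
HB.instance Definition _ := [SubChoice_isSubLmodule of H by <:].

Definition sublie (x y : H) : H := Sub (lie (val x) (val y))
  (S_lie (valP x) (valP y)).

Lemma sublie_linearl y : linear (sublie^~ y).
Proof.
by move=> a x x'; apply: val_inj; rewrite /= lie_linearl.
Qed.

Lemma sublie_linearr x : linear (sublie x).
Proof. by move=> a y y'; apply: val_inj; rewrite /= lie_linearr. Qed.

Lemma subliexx x : sublie x x = 0.
Proof. by apply: val_inj; rewrite /= liexx. Qed.

Lemma sublie_jacobi x y z :
  sublie x (sublie y z) = sublie (sublie x y) z + sublie y (sublie x z).
Proof. by apply: val_inj; rewrite /= lie_jacobi. Qed.

HB.instance Definition _ := Lmodule_isLieAlgebra.Build K H
  sublie_linearl sublie_linearr subliexx sublie_jacobi.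

Variable V : lieModType H.

(* For an element x of the ambient algebra, these assert that x belongs to the
   subalgebra. *)
Definition acts_by_zero (x : L) : Prop :=
  exists2 y : H, val y = x & forall v : V, lact y v = 0.

Definition acts_injectively (x : L) : Prop :=
  exists2 y : H, val y = x & injective (lact y : V -> V).

End LieSubalgebra.

Section FreeAlgebra.
Variables (K : fieldType) (X : choiceType).

(* The vector space on the set of words, with concatenation as product. *)
Definition freealg : Type := freemod K (seq X).

HB.instance Definition _ := GRing.Lmodule.on freealg.

Definition word (s : seq X) : freealg := fbasis s.

Definition freealg_mul : freealg -> freealg -> freealg :=
  lext2 (fun s s' => word (s ++ s')).

Lemma freealg_mul_linearl v : linear (freealg_mul^~ v).
Proof. exact: lext2_linearl. Qed.

Lemma freealg_mul_linearr u : linear (freealg_mul u).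
Proof. exact: lext2_linearr. Qed.

Lemma freealg_mul_word s s' : freealg_mul (word s) (word s') = word (s ++ s').
Proof. exact: lext2_basis. Qed.

Lemma freealg_ind (P : freealg -> Prop) :
  P 0 -> (forall c s u, P u -> P (c *: word s + u)) -> forall u, P u.
Proof. exact: freemod_ind. Qed.

Let fmul0 v := linear_0 (freealg_mul_linearl v).
Let fmulr0 u := linear_0 (freealg_mul_linearr u).
Let mulE := (freealg_mul_linearl, freealg_mul_linearr).

Lemma freealg_mulA : associative freealg_mul.
Proof.
move=> u v w; elim/freealg_ind: u => [|c s u IHu]; first by rewrite !fmul0.
rewrite !mulE IHu; congr (_ *: _ + _).
elim/freealg_ind: {u IHu} v => [|c' s' v IHv]; first by rewrite fmul0 fmulr0 fmul0.
rewrite !mulE IHv; congr (_ *: _ + _).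
elim/freealg_ind: {v IHv} w => [|d t w IHw]; first by rewrite !fmulr0.
by rewrite !mulE IHw !freealg_mul_word catA.
Qed.

Lemma freealg_mul1 : left_id (word [::]) freealg_mul.
Proof.
elim/freealg_ind => [|c s u IHu]; first exact: fmulr0.
by rewrite mulE IHu freealg_mul_word.
Qed.

Lemma freealg_mulr1 : right_id (word [::]) freealg_mul.
Proof.
elim/freealg_ind => [|c s u IHu]; first exact: fmul0.
by rewrite mulE IHu freealg_mul_word cats0.
Qed.

Lemma freealg_mulDl : left_distributive freealg_mul +%R.
Proof.
by move=> u v w; have := freealg_mul_linearl w 1 u v; rewrite !scale1r.
Qed.

Lemma freealg_mulDr : right_distributive freealg_mul +%R.
Proof.
by move=> u v w; have := freealg_mul_linearr u 1 v w; rewrite !scale1r.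
Qed.

Definition freealg_aug : freealg -> K := fcoef [::].

HB.instance Definition _ := GRing.Linear.on freealg_aug.

Lemma freealg_aug_word s : freealg_aug (word s) = (s == [::])%:R.
Proof. exact: fcoef_basis. Qed.

Lemma freealg_1_neq0 : word [::] != 0.
Proof.
apply/eqP => /(congr1 freealg_aug); rewrite freealg_aug_word linear0.
by move/eqP; rewrite oner_eq0.
Qed.

HB.instance Definition _ := GRing.Zmodule_isNzRing.Build freealg
  freealg_mulA freealg_mul1 freealg_mulr1 freealg_mulDl freealg_mulDr
  freealg_1_neq0.

Lemma freealg_scaleAl (a : K) (u v : freealg) :
  a *: freealg_mul u v = freealg_mul (a *: u) v.
Proof.
by have := freealg_mul_linearl v a u 0; rewrite (fmul0 v) !addr0 => ->.
Qed.

HB.instance Definition _ := GRing.Lmodule_isLalgebra.Build K freealg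
  freealg_scaleAl.

Lemma freealg_scaleAr (a : K) (u v : freealg) : a *: (u * v) = u * (a *: v).
Proof.
have := freealg_mul_linearr u a v 0; rewrite (fmulr0 u) !addr0 => E.
exact: esym E.
Qed.

HB.instance Definition _ := GRing.Lalgebra_isAlgebra.Build K freealg
  freealg_scaleAr.

Lemma word_cat s s' : word s * word s' = word (s ++ s').
Proof. exact: freealg_mul_word. Qed.

Lemma word_nil : word [::] = 1.
Proof. by []. Qed.

Lemma freealg_augM u v : freealg_aug (u * v) = freealg_aug u * freealg_aug v.
Proof.
elim/freealg_ind: u => [|c s u IHu]; first by rewrite mul0r !linear0 mul0r.
rewrite mulrDl -scalerAl !linearP /= IHu mulrDl -mulrA; congr (_ * _ + _).
elim/freealg_ind: {u IHu} v => [|d s' v IHv].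
  by rewrite mulr0 !linear0 mulr0.
rewrite mulrDr -scalerAr !linearP /= IHv mulrDr mulrCA word_cat.
by rewrite !freealg_aug_word -natrM mulnb; case: s {IHv}; case: s'.
Qed.

End FreeAlgebra.

Section EnvelopingAlgebra.
Variables (K : fieldType) (L : lieAlgType K).

(* The free associative algebra on the underlying set of L; modulo the
   relations uea_linear below it is the tensor algebra of L. *)
Local Notation F := (freealg K L).

Definition tgen (x : L) : F := word K [:: x].

Variant uea_rel : F -> Prop :=
| uea_linear a x y :
    uea_rel (tgen (a *: x + y) - (a *: tgen x + tgen y))
| uea_bracket x y :
    uea_rel (tgen x * tgen y - tgen y * tgen x - tgen (lie x y)).

Definition two_sided_ideal (I : F -> Prop) : Prop :=
  is_subspace I /\ forall w u, I u -> I (w * u) /\ I (u * w).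

Definition uea_ideal : {pred F} := fun w =>
  `[< forall I, two_sided_ideal I -> (forall r, uea_rel r -> I r) -> I w >].

Lemma uea_idealP w : w \in uea_ideal <->
  forall I, two_sided_ideal I -> (forall r, uea_rel r -> I r) -> I w.
Proof. by rewrite unfold_in; split => /asboolP. Qed.

Lemma uea_ideal_closed : submod_closed uea_ideal.
Proof.
split; first by apply/uea_idealP => I [[]].
move=> a u v /uea_idealP Iu /uea_idealP Iv; apply/uea_idealP => I sI rI.
by apply: sI.1.2; [exact: Iu|exact: Iv].
Qed.

HB.instance Definition _ := GRing.isSubmodClosed.Build K F uea_ideal
  uea_ideal_closed.

Lemma uea_idealMl w u : u \in uea_ideal -> w * u \in uea_ideal.
Proof.
move=> /uea_idealP Iu; apply/uea_idealP => I sI rI.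
by have [] := sI.2 w u (Iu I sI rI).
Qed.

Lemma uea_idealMr w u : u \in uea_ideal -> u * w \in uea_ideal.
Proof.
move=> /uea_idealP Iu; apply/uea_idealP => I sI rI.
by have [] := sI.2 w u (Iu I sI rI).
Qed.

Lemma mem_uea_ideal r : uea_rel r -> r \in uea_ideal.
Proof. by move=> rr; apply/uea_idealP => I _; apply. Qed.

Definition uea : Type := lquot uea_ideal.

HB.instance Definition _ := GRing.Lmodule.on uea.

Definition uea_pi : F -> uea := @lpi K F uea_ideal.

HB.instance Definition _ := GRing.Linear.on uea_pi.

Definition uea_one : uea := uea_pi 1.

Definition uea_mul (x y : uea) : uea := uea_pi (lrepr x * lrepr y).

Lemma uea_pi_surj (x : uea) : exists w, x = uea_pi w.
Proof. exact: lpi_surj. Qed.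

Lemma uea_mulE u v : uea_mul (uea_pi u) (uea_pi v) = uea_pi (u * v).
Proof.
apply/lpi_eq; set u' := lrepr _; set v' := lrepr _.
have -> : u' * v' - u * v = (u' - u) * v' + u * (v' - v).
  by rewrite mulrBl mulrBr addrA subrK.
apply: rpredD; first by apply: uea_idealMr; exact: lrepr_lpi.
by apply: uea_idealMl; exact: lrepr_lpi.
Qed.

Lemma uea_mulA : associative uea_mul.
Proof.
move=> x y z; have [u ->] := uea_pi_surj x; have [v ->] := uea_pi_surj y.
by have [w ->] := uea_pi_surj z; rewrite !uea_mulE mulrA.
Qed.

Lemma uea_mul1 : left_id uea_one uea_mul.
Proof. by move=> x; have [u ->] := uea_pi_surj x; rewrite uea_mulE mul1r. Qed.

Lemma uea_mulr1 : right_id uea_one uea_mul.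
Proof. by move=> x; have [u ->] := uea_pi_surj x; rewrite uea_mulE mulr1. Qed.

Lemma uea_mulDl : left_distributive uea_mul +%R.
Proof.
move=> x y z; have [u ->] := uea_pi_surj x; have [v ->] := uea_pi_surj y.
have [w ->] := uea_pi_surj z.
by rewrite -linearD /= !uea_mulE mulrDl linearD.
Qed.

Lemma uea_mulDr : right_distributive uea_mul +%R.
Proof.
move=> x y z; have [u ->] := uea_pi_surj x; have [v ->] := uea_pi_surj y.
have [w ->] := uea_pi_surj z.
by rewrite -linearD /= !uea_mulE mulrDr linearD.
Qed.

Lemma uea_one_neq0 : uea_one != 0.
Proof.
apply/eqP; rewrite -(linear0 uea_pi) => /lpi_eq; rewrite subr0.
move=> /uea_idealP/(_ (fun w => freealg_aug w = 0)) H.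
have t0 z : freealg_aug (tgen z) = 0 by rewrite freealg_aug_word.
have : freealg_aug (1 : F) = 0.
  apply: H => [|_ [a x y|x y]].
  - split; last by move=> w u u0; rewrite !freealg_augM u0 mulr0 mul0r.
    split; first exact: linear0.
    by move=> a u v u0 v0; rewrite linearP /= u0 v0 mulr0 addr0.
  - by rewrite linearB linearP /= !t0 mulr0 addr0 subr0.
  - by rewrite !linearB /= !freealg_augM !t0 mulr0 !subr0.
by rewrite -word_nil freealg_aug_word => /eqP; rewrite oner_eq0.
Qed.

HB.instance Definition _ := GRing.Zmodule_isNzRing.Build uea
  uea_mulA uea_mul1 uea_mulr1 uea_mulDl uea_mulDr uea_one_neq0.

Lemma uea_piM u v : uea_pi u * uea_pi v = uea_pi (u * v).
Proof. exact: uea_mulE. Qed.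

Lemma uea_piZ a u : a *: uea_pi u = uea_pi (a *: u).
Proof. by rewrite linearZ. Qed.

Lemma uea_scaleAl (a : K) (x y : uea) : a *: (x * y) = (a *: x) * y.
Proof.
have [u ->] := uea_pi_surj x; have [v ->] := uea_pi_surj y.
by rewrite uea_piM !uea_piZ uea_piM scalerAl.
Qed.

HB.instance Definition _ := GRing.Lmodule_isLalgebra.Build K uea uea_scaleAl.

Lemma uea_scaleAr (a : K) (x y : uea) : a *: (x * y) = x * (a *: y).
Proof.
have [u ->] := uea_pi_surj x; have [v ->] := uea_pi_surj y.
by rewrite uea_piM !uea_piZ uea_piM freealg_scaleAr.
Qed.

HB.instance Definition _ := GRing.Lalgebra_isAlgebra.Build K uea uea_scaleAr.

Lemma uea_pi1 : uea_pi 1 = 1.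
Proof. by []. Qed.

Definition uea_in (x : L) : uea := uea_pi (tgen x).

Lemma uea_in_is_linear : linear uea_in.
Proof.
move=> a x y; rewrite /uea_in uea_piZ -linearD /=.
by apply/lpi_eq; apply: mem_uea_ideal; exact: uea_linear.
Qed.

HB.instance Definition _ :=
  GRing.isLinear.Build K L uea *:%R uea_in uea_in_is_linear.

Lemma uea_in_lie x y :
  uea_in (lie x y) = uea_in x * uea_in y - uea_in y * uea_in x.
Proof.
rewrite /uea_in !uea_piM -linearB /=; symmetry.
by apply/lpi_eq; apply: mem_uea_ideal; exact: uea_bracket.
Qed.

End EnvelopingAlgebra.

Section EnvelopingLift.
Variables (K : fieldType) (L : lieAlgType K) (A : algType K) (f : L -> A).
Local Notation F := (freealg K L).

Definition free_lift : F -> A := lext (fun s => \prod_(x <- s) f x).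

HB.instance Definition _ := GRing.Linear.on free_lift.

Definition uea_lift : uea L -> A := lquot_lift free_lift.

Lemma free_lift_word s : free_lift (word K s) = \prod_(x <- s) f x.
Proof. exact: lext_basis. Qed.

Lemma free_lift1 : free_lift 1 = 1.
Proof. by rewrite -word_nil free_lift_word big_nil. Qed.

Lemma free_lift_gen x : free_lift (tgen x) = f x.
Proof. by rewrite free_lift_word big_seq1. Qed.

Lemma free_liftM u v : free_lift (u * v) = free_lift u * free_lift v.
Proof.
elim/freealg_ind: u => [|c s u IHu]; first by rewrite linear0 !mul0r linear0.
rewrite mulrDl linearP /= -scalerAl !linearD !linearZ /= IHu mulrDl -scalerAl.
congr (_ *: _ + _); elim/freealg_ind: {u IHu} v => [|d s' v IHv].
  by rewrite linear0 !mulr0 linear0.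
rewrite mulrDr -freealg_scaleAr !linearP /= IHv mulrDr -scalerAr.
by rewrite word_cat !free_lift_word big_cat.
Qed.

Hypothesis f_lin : linear f.
Hypothesis f_lie : forall x y, f (lie x y) = f x * f y - f y * f x.

Lemma free_lift_ideal w : w \in @uea_ideal K L -> free_lift w = 0.
Proof.
move=> /uea_idealP/(_ (fun w => free_lift w = 0)); apply=> [|_ [a x y|x y]].
- split; last first.
    by move=> w' u u0; rewrite !free_liftM u0 mulr0 mul0r.
  split; first exact: linear0.
  by move=> a u v u0 v0; rewrite linearP /= u0 v0 scaler0 addr0.
- by rewrite linearB linearP /= !free_lift_gen f_lin subrr.
- by rewrite !linearB /= !free_liftM !free_lift_gen f_lie subrr.
Qed.

Lemma uea_liftE w : uea_lift (uea_pi w) = free_lift w.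
Proof. exact: lquot_liftE free_lift_ideal. Qed.

Lemma uea_lift_in x : uea_lift (uea_in x) = f x.
Proof. by rewrite uea_liftE free_lift_gen. Qed.

Lemma uea_lift1 : uea_lift 1 = 1.
Proof. by rewrite -uea_pi1 uea_liftE free_lift1. Qed.

Lemma uea_liftM x y : uea_lift (x * y) = uea_lift x * uea_lift y.
Proof.
have [u ->] := uea_pi_surj x; have [v ->] := uea_pi_surj y.
by rewrite uea_piM !uea_liftE free_liftM.
Qed.

Lemma uea_lift_linear : linear uea_lift.
Proof.
move=> a x y; have [u ->] := uea_pi_surj x; have [v ->] := uea_pi_surj y.
by rewrite uea_piZ -linearD /= !uea_liftE linearP.
Qed.

End EnvelopingLift.

Section EnvelopingAction.
Variables (K : fieldType) (L : lieAlgType K) (V : lieModType L).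
Local Notation F := (freealg K L).

Definition free_act (v : V) : F -> V := lext (fun s => foldr lact v s).

HB.instance Definition _ v := GRing.Linear.on (free_act v).

Definition uea_act (u : uea L) (v : V) : V := lquot_lift (free_act v) u.

Lemma free_act_word v s : free_act v (word K s) = foldr lact v s.
Proof. exact: lext_basis. Qed.

Lemma free_act1 v : free_act v 1 = v.
Proof. by rewrite -word_nil free_act_word. Qed.

Lemma free_act_gen x v : free_act v (tgen x) = lact x v.
Proof. by rewrite free_act_word. Qed.

Lemma free_act_linear w : linear (free_act^~ w).
Proof.
move=> a v v'; elim/freealg_ind: w => [|c s w IH].
  by rewrite /= !linear0 addr0.
rewrite /= !linearP /= IH !free_act_word.
have -> : foldr lact (a *: v + v') s =
    a *: foldr lact v s + foldr lact v' s.
  by elim: s => //= x s ->; rewrite lact_linearr.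
by rewrite !scalerDr !scalerA [c * a]mulrC addrACA.
Qed.

Lemma free_actM u w v : free_act v (u * w) = free_act (free_act v w) u.
Proof.
elim/freealg_ind: u => [|c s u IHu]; first by rewrite mul0r !linear0.
rewrite mulrDl -scalerAl !linearP /= IHu.
congr (_ *: _ + _); elim/freealg_ind: {u IHu} w => [|d s' w IHw].
  rewrite mulr0 !linear0 free_act_word.
  by elim: s => //= x s <-; rewrite linear0.
rewrite mulrDr -freealg_scaleAr !linearP /= IHw word_cat free_act_linear.
by rewrite !free_act_word foldr_cat.
Qed.

Lemma free_act_ideal w v : w \in @uea_ideal K L -> free_act v w = 0.
Proof.
move=> /uea_idealP/(_ (fun w => forall v, free_act v w = 0)) H.
apply: H v => [|_ [a x y|x y] v].
- split; last first.
    move=> w' u u0; split=> v; rewrite free_actM u0 //.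
    have := free_act_linear w' (-1) 0 0.
    by rewrite scaler0 addr0 scaleN1r addNr.
  split; first by move=> v; exact: linear0.
  by move=> a u u' u0 u'0 v; rewrite linearP /= u0 u'0 scaler0 addr0.
- by rewrite linearB linearP /= !free_act_gen lact_linearl subrr.
- by rewrite !linearB /= !free_actM !free_act_gen lact_lie subrr.
Qed.

Lemma uea_actE w v : uea_act (uea_pi w) v = free_act v w.
Proof. by apply: lquot_liftE => w'; exact: free_act_ideal. Qed.

Lemma uea_act_in x v : uea_act (uea_in x) v = lact x v.
Proof. by rewrite uea_actE free_act_gen. Qed.

Lemma uea_act1 v : uea_act 1 v = v.
Proof. by rewrite -uea_pi1 uea_actE free_act1. Qed.

Lemma uea_actM a b v : uea_act (a * b) v = uea_act a (uea_act b v).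
Proof.
have [u ->] := uea_pi_surj a; have [w ->] := uea_pi_surj b.
by rewrite uea_piM !uea_actE free_actM.
Qed.

End EnvelopingAction.

(* B is regarded as a right A-module through f : A -> B and N as a left
   A-module through act. *)
Section TensorProduct.
Variables (K : fieldType) (A : Type) (B : algType K) (N : lmodType K).
Variables (f : A -> B) (act : A -> N -> N).

Local Notation T0 := (freemod K (B * N)%type).

Definition pure0 (b : B) (n : N) : T0 := fbasis (b, n).

Variant tens_rel : T0 -> Prop :=
| tens_linearl c b b' n :
    tens_rel (pure0 (c *: b + b') n - (c *: pure0 b n + pure0 b' n))
| tens_linearr c b n n' :
    tens_rel (pure0 b (c *: n + n') - (c *: pure0 b n + pure0 b n'))
| tens_balanced b a n :
    tens_rel (pure0 (b * f a) n - pure0 b (act a n)).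

Definition tens : Type := lquot (lspan tens_rel).

HB.instance Definition _ := GRing.Lmodule.on tens.

Definition tens_pi : T0 -> tens := @lpi K T0 (lspan tens_rel).

HB.instance Definition _ := GRing.Linear.on tens_pi.

Definition pure (b : B) (n : N) : tens := tens_pi (pure0 b n).

Lemma tens_pi_surj t : exists w, t = tens_pi w.
Proof. exact: lpi_surj. Qed.

Lemma tens_pi_rel u v : tens_rel (u - v) -> tens_pi u = tens_pi v.
Proof. by move=> r; apply/lpi_eq; exact: mem_lspan. Qed.

Lemma pure_linearl n : linear (pure^~ n).
Proof.
move=> c b b'; rewrite /pure -linearP /=; apply: tens_pi_rel.
exact: tens_linearl.
Qed.

Lemma pure_linearr b : linear (pure b).
Proof.
move=> c n n'; rewrite /pure -linearP /=; apply: tens_pi_rel.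
exact: tens_linearr.
Qed.

Lemma pure_balanced b a n : pure (b * f a) n = pure b (act a n).
Proof. by apply: tens_pi_rel; exact: tens_balanced. Qed.

Definition tens_lmul0 (b : B) : T0 -> tens :=
  lext (fun p : B * N => pure (b * p.1) p.2).

HB.instance Definition _ b := GRing.Linear.on (tens_lmul0 b).

Definition tens_lmul (b : B) : tens -> tens := lquot_lift (tens_lmul0 b).

Lemma tens_lmulE b w : tens_lmul b (tens_pi w) = tens_lmul0 b w.
Proof.
apply: lquot_liftE; apply: lspan_ker => _ [c b1 b2 n|c b1 n n'|b1 a n].
- rewrite linearB linearP /= /tens_lmul0 !lext_basis /=.
  by rewrite mulrDr -scalerAr pure_linearl subrr.
- by rewrite linearB linearP /= /tens_lmul0 !lext_basis /= pure_linearr subrr.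
- by rewrite linearB /= /tens_lmul0 !lext_basis /= mulrA pure_balanced subrr.
Qed.

Lemma tens_lmul_pure b b' n : tens_lmul b (pure b' n) = pure (b * b') n.
Proof. by rewrite tens_lmulE /tens_lmul0 lext_basis. Qed.

Lemma tens_lmul_linearr b : linear (tens_lmul b).
Proof.
move=> c s t; have [u ->] := tens_pi_surj s; have [v ->] := tens_pi_surj t.
by rewrite -linearP /= !tens_lmulE linearP.
Qed.

Lemma tens_lmul_0 b : tens_lmul b 0 = 0.
Proof. by rewrite -[in LHS](linear0 tens_pi) tens_lmulE linear0. Qed.

Lemma tens_ind (P : tens -> Prop) :
  P 0 -> (forall b n t, P t -> P (pure b n + t)) -> forall t, P t.
Proof.
move=> P0 PD t; have [w ->] := tens_pi_surj t.
move: w {t}; apply: freemod_ind => [|c [b n] w Pw]; first by rewrite linear0.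
rewrite linearP /= -[tens_pi (fbasis _)]/(pure b n).
suff -> : c *: pure b n = pure (c *: b) n by exact: PD.
have := pure_linearl n c b 0.
suff -> : pure 0 n = 0 by rewrite !addr0.
by have := pure_linearl n (-1) 0 0; rewrite scaler0 addr0 scaleN1r addNr.
Qed.

Lemma tens_lmul_linearl t : linear (tens_lmul^~ t).
Proof.
move=> c b b'; move: t; apply: tens_ind => [|b1 n t IH].
  by rewrite !tens_lmul_0 scaler0 addr0.
have addE b2 : tens_lmul b2 (pure b1 n + t)
    = pure (b2 * b1) n + tens_lmul b2 t.
  have := tens_lmul_linearr b2 1 (pure b1 n) t.
  by rewrite !scale1r tens_lmul_pure.
by rewrite !addE IH mulrDl -scalerAl pure_linearl scalerDr addrACA.
Qed.

Lemma tens_lmulM b b' t : tens_lmul (b * b') t = tens_lmul b (tens_lmul b' t).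
Proof.
move: t; apply: tens_ind => [|b1 n t IH].
  by rewrite !tens_lmul_0.
have addE b2 b3 n' t' : tens_lmul b2 (pure b3 n' + t')
    = pure (b2 * b3) n' + tens_lmul b2 t'.
  have := tens_lmul_linearr b2 1 (pure b3 n') t'.
  by rewrite !scale1r tens_lmul_pure.
by rewrite !addE IH mulrA.
Qed.

End TensorProduct.

Section Induction.
Variables (K : fieldType) (L : lieAlgType K) (S : submodClosed L).
Variables (S_lie : lie_closed S) (V : lieModType (subalg S_lie)).

Definition uea_incl : uea (subalg S_lie) -> uea L :=
  uea_lift (fun x : subalg S_lie => uea_in (val x)).

Lemma uea_incl_in x : uea_incl (uea_in x) = uea_in (val x).
Proof.
apply: uea_lift_in => [c y z|y z]; first by rewrite linearP.
exact: uea_in_lie.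
Qed.

Definition induced : Type := tens uea_incl (@uea_act K (subalg S_lie) V).

HB.instance Definition _ := GRing.Lmodule.on induced.

Definition induced_act (x : L) : induced -> induced := tens_lmul (uea_in x).

Lemma induced_act_linearl t : linear (induced_act^~ t).
Proof. by move=> c x y; rewrite /induced_act linearP /= tens_lmul_linearl. Qed.

Lemma induced_act_linearr x : linear (induced_act x).
Proof. exact: tens_lmul_linearr. Qed.

Lemma induced_act_lie x y t : induced_act (lie x y) t =
  induced_act x (induced_act y t) - induced_act y (induced_act x t).
Proof.
rewrite /induced_act uea_in_lie -!tens_lmulM.
have := tens_lmul_linearl t (-1) (uea_in y * uea_in x) (uea_in x * uea_in y).
by rewrite !scaleN1r ![- _ + _]addrC.
Qed.

HB.instance Definition _ := Lmodule_isLieModule.Build K L induced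
  induced_act_linearl induced_act_linearr induced_act_lie.

End Induction.

Section BilinearBracket.
Variables (K : fieldType) (B : Type) (T : lmodType K) (e : B -> T).
Variable br : T -> T -> T.
Hypothesis e_ind : forall P : T -> Prop,
  P 0 -> (forall c b u, P u -> P (c *: e b + u)) -> forall u, P u.
Hypothesis br_linearl : forall v, linear (br^~ v).
Hypothesis br_linearr : forall u, linear (br u).

Lemma bracket0l v : br 0 v = 0.
Proof. by have := br_linearl v (-1) 0 0; rewrite scaler0 addr0 scaleN1r addNr. Qed.

Lemma bracket0r u : br u 0 = 0.
Proof. by have := br_linearr u (-1) 0 0; rewrite scaler0 addr0 scaleN1r addNr. Qed.

Lemma bracketDl u v w : br (u + v) w = br u w + br v w.
Proof. by have := br_linearl w 1 u v; rewrite !scale1r. Qed.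

Lemma bracketDr u v w : br u (v + w) = br u v + br u w.
Proof. by have := br_linearr u 1 v w; rewrite !scale1r. Qed.

Lemma bracketZl c u w : br (c *: u) w = c *: br u w.
Proof. by have := br_linearl w c u 0; rewrite bracket0l !addr0. Qed.

Lemma bracketZr c u w : br u (c *: w) = c *: br u w.
Proof. by have := br_linearr u c w 0; rewrite bracket0r !addr0. Qed.

Lemma bracketNl u w : br (- u) w = - br u w.
Proof. by rewrite -scaleN1r bracketZl scaleN1r. Qed.

Lemma bracketNr u w : br u (- w) = - br u w.
Proof. by rewrite -scaleN1r bracketZr scaleN1r. Qed.

Definition bracketE := (bracket0l, bracket0r, bracketDl, bracketDr,
  bracketZl, bracketZr, bracketNl, bracketNr).

Hypothesis br_alt : forall a, br (e a) (e a) = 0.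
Hypothesis br_anti : forall a b, br (e a) (e b) = - br (e b) (e a).

Lemma bracket_anti u v : br u v = - br v u.
Proof.
elim/e_ind: u => [|c a u IHu]; first by rewrite !bracketE oppr0.
rewrite !bracketE opprD IHu -scalerN; congr (_ *: _ + _).
elim/e_ind: {u IHu} v => [|d b v IHv]; first by rewrite !bracketE oppr0.
by rewrite !bracketE opprD -scalerN IHv br_anti.
Qed.

Lemma bracketxx u : br u u = 0.
Proof.
elim/e_ind: u => [|c a u IHu]; first by rewrite !bracketE.
rewrite !bracketE IHu br_alt !scaler0 add0r addr0.
by rewrite [br u _]bracket_anti scalerN subrr.
Qed.

Hypothesis br_jacobi : forall a b c, br (e a) (br (e b) (e c)) =
  br (br (e a) (e b)) (e c) + br (e b) (br (e a) (e c)).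

Lemma bracket_jacobi u v w : br u (br v w) = br (br u v) w + br v (br u w).
Proof.
elim/e_ind: u => [|c a u IHu]; first by rewrite !bracketE addr0.
rewrite !bracketE IHu addrACA -scalerDr; congr (_ *: _ + _).
elim/e_ind: {u IHu} v => [|d b v IHv]; first by rewrite !bracketE addr0.
rewrite !bracketE IHv addrACA -scalerDr; congr (_ *: _ + _).
elim/e_ind: {v IHv} w => [|f x w IHw]; first by rewrite !bracketE addr0.
by rewrite !bracketE IHw addrACA -scalerDr br_jacobi.
Qed.

End BilinearBracket.

Variant age_basis : Set := gen_e | gen_h | gen_p | gen_q | gen_z.

Definition age_basis_code (a : age_basis) : nat :=
  match a with gen_e => 0 | gen_h => 1 | gen_p => 2 | gen_q => 3 | gen_z => 4 end.

Definition age_basis_decode (n : nat) : age_basis :=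
  match n with 0 => gen_e | 1 => gen_h | 2 => gen_p | 3 => gen_q | _ => gen_z end.

Lemma age_basis_codeK : cancel age_basis_code age_basis_decode.
Proof. by case. Qed.

HB.instance Definition _ := Countable.copy age_basis (can_type age_basis_codeK).

Definition age_table (K : fieldType) (T : lmodType K) (v : age_basis -> T)
    (a b : age_basis) : T :=
  match a, b with
  | gen_h, gen_e => 2 *: v gen_e     | gen_e, gen_h => - (2 *: v gen_e)
  | gen_h, gen_p => v gen_p          | gen_p, gen_h => - v gen_p
  | gen_h, gen_q => - v gen_q        | gen_q, gen_h => v gen_q
  | gen_e, gen_q => v gen_p          | gen_q, gen_e => - v gen_p
  | gen_p, gen_q => v gen_z          | gen_q, gen_p => - v gen_z
  | _, _ => 0
  end.

Lemma age_table_alt (K : fieldType) (T : lmodType K) (v : age_basis -> T) a :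
  age_table v a a = 0.
Proof. by case: a. Qed.

Lemma age_table_anti (K : fieldType) (T : lmodType K) (v : age_basis -> T) a b :
  age_table v a b = - age_table v b a.
Proof. by case: a; case: b; rewrite /= ?opprK ?oppr0. Qed.

Lemma age_table_jacobi (K : fieldType) (T : lmodType K) (v : age_basis -> T)
    (br : T -> T -> T) :
  (forall w, linear (br^~ w)) -> (forall w, linear (br w)) ->
  (forall a b, br (v a) (v b) = age_table v a b) ->
  forall a b c, br (v a) (br (v b) (v c)) =
    br (br (v a) (v b)) (v c) + br (v b) (br (v a) (v c)).
Proof.
move=> ll lr brE a b c.
have bE := (bracket0l ll, bracket0r lr, bracketZl ll, bracketZr lr,
  bracketNl ll, bracketNr lr).
rewrite !brE; case: a; case: b; case: c;
  rewrite /= !(bE, brE) /= ?(scaler0, oppr0, addr0, add0r, opprK, subrr, addNr,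
    scalerN) //.
all: rewrite -?[2]/(1 + 1) ?scalerDl ?scale1r ?opprD ?addrA.
all: rewrite ?subrr ?addNr ?add0r ?addrK ?addrNK ?subrK //.
Qed.

Section Age.
Variable K : fieldType.

Definition age : Type := freemod K age_basis.

HB.instance Definition _ := GRing.Lmodule.on age.

Definition age_gen (a : age_basis) : age := fbasis a.

Definition age_lie : age -> age -> age := lext2 (age_table age_gen).

Lemma age_lie_gen a b : age_lie (age_gen a) (age_gen b) = age_table age_gen a b.
Proof. exact: lext2_basis. Qed.

Lemma age_lie_linearl y : linear (age_lie^~ y).
Proof. exact: lext2_linearl. Qed.

Lemma age_lie_linearr x : linear (age_lie x).
Proof. exact: lext2_linearr. Qed.

Lemma age_ind (P : age -> Prop) :
  P 0 -> (forall c a x, P x -> P (c *: age_gen a + x)) -> forall x, P x.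
Proof. exact: freemod_ind. Qed.

Lemma age_liexx x : age_lie x x = 0.
Proof.
apply: (bracketxx age_ind age_lie_linearl age_lie_linearr) => [a|a b];
  rewrite !age_lie_gen; [exact: age_table_alt|exact: age_table_anti].
Qed.

Lemma age_lie_jacobi x y z :
  age_lie x (age_lie y z) = age_lie (age_lie x y) z + age_lie y (age_lie x z).
Proof.
apply: (bracket_jacobi age_ind age_lie_linearl age_lie_linearr).
exact: age_table_jacobi age_lie_linearl age_lie_linearr age_lie_gen.
Qed.

HB.instance Definition _ := Lmodule_isLieAlgebra.Build K age
  age_lie_linearl age_lie_linearr age_liexx age_lie_jacobi.

(* The symmetric bilinear form with (h|h) = 1 for which all other pairings of
   basis elements vanish. *)
Definition age_form (x y : age) : K :=
  fcoef gen_h x * fcoef gen_h y.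

End Age.

Section AffineAge.
Variable K : fieldType.

(* Some (a, m) stands for the basis element a (x) t^m, and None for k. *)
Definition affage : Type := freemod K (option (age_basis * int)).

HB.instance Definition _ := GRing.Lmodule.on affage.

Definition affage_gen (a : age_basis) (m : int) : affage := fbasis (Some (a, m)).

Definition affage_k : affage := fbasis None.

Definition affage_basis (i : option (age_basis * int)) : affage := fbasis i.

(* x (x) t^m *)
Definition affage_loop (m : int) : age K -> affage :=
  lext (fun a => affage_gen a m).

Definition affage_table (i j : option (age_basis * int)) : affage :=
  match i, j with
  | Some (a, m), Some (b, n) =>
      affage_loop (m + n) (lie (age_gen K a) (age_gen K b))
      + (m%:~R * age_form (age_gen K a) (age_gen K b) * (m + n == 0)%:R)
        *: affage_k
  | _, _ => 0
  end.

Definition affage_lie : affage -> affage -> affage := lext2 affage_table.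

Lemma affage_lie_basis i j :
  affage_lie (affage_basis i) (affage_basis j) = affage_table i j.
Proof. exact: lext2_basis. Qed.

Lemma affage_lie_linearl y : linear (affage_lie^~ y).
Proof. exact: lext2_linearl. Qed.

Lemma affage_lie_linearr x : linear (affage_lie x).
Proof. exact: lext2_linearr. Qed.

Lemma affage_ind (P : affage -> Prop) :
  P 0 -> (forall c i x, P x -> P (c *: affage_basis i + x)) -> forall x, P x.
Proof. exact: freemod_ind. Qed.

Lemma affage_loop_linear m : linear (affage_loop m).
Proof. exact: lext_is_linear. Qed.

HB.instance Definition _ m := GRing.isLinear.Build K (age K) affage *:%R
  (affage_loop m) (affage_loop_linear m).

Lemma affage_loop_gen m a : affage_loop m (age_gen K a) = affage_gen a m.
Proof. exact: lext_basis. Qed.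

Lemma age_form_linearr (x : age K) : scalar (age_form x).
Proof.
by move=> c y z; rewrite /age_form linearP /= mulrDr mulrCA.
Qed.

Lemma age_form_linearl (y : age K) : scalar (fun x : age K => age_form x y).
Proof.
by move=> c x z; rewrite /age_form linearP /= mulrDl mulrA.
Qed.

Lemma age_form_lie (x y z : age K) : age_form x (lie y z) = 0.
Proof.
rewrite /age_form.
suff -> : fcoef gen_h (lie y z) = 0 by rewrite mulr0.
elim/age_ind: y => [|c a y IHy].
  by rewrite (bracket0l (@lie_linearl K (age K))) linear0.
rewrite lie_linearl linearP /= IHy addr0.
elim/age_ind: {y IHy} z => [|d b z IHz].
  by rewrite (bracket0r (@lie_linearr K (age K))) linear0 mulr0.
rewrite lie_linearr linearP /= mulrDr IHz addr0.
rewrite -[lie _ _]/(age_lie _ _) age_lie_gen /age_table.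
by case: a {IHz}; case: b; rewrite ?(linear0, linearN, linearZ) /= ?fcoef_basis /=
  ?(mulr0n, oppr0, mulr0).
Qed.

Lemma affage_kl y : affage_lie affage_k y = 0.
Proof.
elim/affage_ind: y => [|c i y IHy]; first exact: bracket0r affage_lie_linearr _.
by rewrite affage_lie_linearr IHy (affage_lie_basis None) scaler0 addr0.
Qed.

Lemma affage_kr y : affage_lie y affage_k = 0.
Proof.
elim/affage_ind: y => [|c i y IHy]; first exact: bracket0l affage_lie_linearl _.
rewrite affage_lie_linearl IHy (affage_lie_basis i None).
by case: i => [[a m]|]; rewrite scaler0 addr0.
Qed.

Definition affage_pair (m n : int) (x y : age K) : affage :=
  affage_loop (m + n) (lie x y)
    + (m%:~R * age_form x y * (m + n == 0)%:R) *: affage_k.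

Lemma affage_pair_linearl m n y : linear (fun x => affage_pair m n x y).
Proof.
move=> c x x'; rewrite /affage_pair lie_linearl affage_loop_linear.
rewrite age_form_linearl /= mulrDr mulrDl scalerDl scalerDr scalerA.
by rewrite mulrCA -!mulrA addrACA.
Qed.

Lemma affage_pair_linearr m n x : linear (affage_pair m n x).
Proof.
move=> c y y'; rewrite /affage_pair lie_linearr affage_loop_linear.
rewrite age_form_linearr /= mulrDr mulrDl scalerDl scalerDr scalerA.
by rewrite mulrCA -!mulrA addrACA.
Qed.

Lemma affage_lie_loop m n x y :
  affage_lie (affage_loop m x) (affage_loop n y) = affage_pair m n x y.
Proof.
elim/age_ind: x => [|c a x IHx].
  rewrite linear0 (linear_0 (affage_pair_linearl _ _ _)).
  exact: linear_0 (affage_lie_linearl _).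
rewrite affage_loop_linear affage_lie_linearl affage_pair_linearl IHx.
congr (_ *: _ + _); elim/age_ind: {x IHx} y => [|d b y IHy].
  rewrite linear0 (linear_0 (affage_pair_linearr _ _ _)).
  exact: linear_0 (affage_lie_linearr _).
rewrite affage_loop_linear affage_lie_linearr affage_pair_linearr IHy.
by rewrite !affage_loop_gen (affage_lie_basis (Some _) (Some _)).
Qed.

Lemma affage_lie_alt i : affage_lie (affage_basis i) (affage_basis i) = 0.
Proof.
case: i => [[a m]|]; last exact: affage_kl.
rewrite affage_lie_basis /= liexx linear0 add0r.
have [|_] := eqVneq (m + m) 0; last by rewrite mulr0 scale0r.
rewrite -mulr2n => /eqP; rewrite mulrn_eq0 /= => /eqP ->.
by rewrite mulr0z !mul0r scale0r.
Qed.

Lemma age_form_sym (x y : age K) : age_form x y = age_form y x.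
Proof. exact: mulrC. Qed.

Lemma affage_lie_anti i j : affage_lie (affage_basis i) (affage_basis j) =
  - affage_lie (affage_basis j) (affage_basis i).
Proof.
case: i j => [[a m]|] [[b n]|]; rewrite !affage_lie_basis /= ?oppr0 //.
have -> : lie (age_gen K a) (age_gen K b) = - lie (age_gen K b) (age_gen K a).
  by rewrite ![lie _ _]age_lie_gen; exact: age_table_anti.
rewrite linearN /= opprD addrC [n + m]addrC -scaleNr age_form_sym [RHS]addrC.
congr (_ *: _ + _); have [|_] := eqVneq (m + n) 0; last by rewrite !mulr0 oppr0.
by move/eqP; rewrite addr_eq0 => /eqP ->; rewrite mulrNz !mulNr.
Qed.

Lemma affage_lie_jacobi_basis i j l :
  affage_lie (affage_basis i) (affage_lie (affage_basis j) (affage_basis l)) =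
  affage_lie (affage_lie (affage_basis i) (affage_basis j)) (affage_basis l)
  + affage_lie (affage_basis j)
      (affage_lie (affage_basis i) (affage_basis l)).
Proof.
have l0 x : affage_lie x 0 = 0 := linear_0 (affage_lie_linearr x).
have l0' x : affage_lie 0 x = 0 := linear_0 (affage_lie_linearl x).
have kE : affage_basis None = affage_k by [].
case: i => [[a m]|]; last by rewrite !kE !affage_kl l0 l0' addr0.
case: j => [[b n]|]; last by rewrite !kE !affage_kl affage_kr l0' addr0.
case: l => [[c r]|]; last by rewrite !kE !affage_kr !l0 addr0.
rewrite -![affage_basis (Some _)]/(affage_gen _ _) -!affage_loop_gen.
move: (age_gen K a) (age_gen K b) (age_gen K c) => x y z.
have bE := (bracketDl affage_lie_linearl, bracketDr affage_lie_linearr,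
  bracketZl affage_lie_linearl, bracketZr affage_lie_linearr).
rewrite !affage_lie_loop /affage_pair !bE !affage_kl !affage_kr !scaler0 !addr0.
rewrite !affage_lie_loop /affage_pair [age_form (lie _ _) _]age_form_sym.
rewrite !age_form_lie !mulr0 !mul0r !scale0r !addr0 lie_jacobi.
rewrite [n + (m + r)]addrCA -!addrA.
by rewrite linearD.
Qed.

Lemma affage_liexx x : affage_lie x x = 0.
Proof.
exact: (bracketxx affage_ind affage_lie_linearl affage_lie_linearr
  affage_lie_alt affage_lie_anti).
Qed.

Lemma affage_lie_jacobi x y z : affage_lie x (affage_lie y z) =
  affage_lie (affage_lie x y) z + affage_lie y (affage_lie x z).
Proof.
exact: (bracket_jacobi affage_ind affage_lie_linearl affage_lie_linearr
  affage_lie_jacobi_basis).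
Qed.

HB.instance Definition _ := Lmodule_isLieAlgebra.Build K affage
  affage_lie_linearl affage_lie_linearr affage_liexx affage_lie_jacobi.

End AffineAge.

Section AgeSubalgebra.
Variables (K : fieldType) (d1 d2 d3 : int).

Definition age_sub_index (i : option (age_basis * int)) : bool :=
  match i with
  | Some (gen_e, m) => d1 <= m
  | Some (gen_h, m) => 0 <= m
  | Some (gen_p, m) => d2 <= m
  | Some (gen_q, m) => d3 <= m
  | Some (gen_z, _) | None => true
  end.

Definition age_sub : {pred affage K} := fun x =>
  `[< forall i, ~~ age_sub_index i -> fcoef i x = 0 >].

Lemma age_subP (x : affage K) :
  x \in age_sub <-> forall i, ~~ age_sub_index i -> fcoef i x = 0.
Proof. by rewrite unfold_in; split => /asboolP. Qed.

Lemma age_sub_closed : submod_closed age_sub.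
Proof.
split; first by apply/age_subP => i _; rewrite linear0.
move=> c x y /age_subP Sx /age_subP Sy; apply/age_subP => i ni.
by rewrite linearP /= Sx // Sy // mulr0 addr0.
Qed.

HB.instance Definition _ := GRing.isSubmodClosed.Build K (affage K) age_sub
  age_sub_closed.

Lemma age_sub_basis i : (affage_basis K i \in age_sub) = age_sub_index i.
Proof.
apply/idP/idP => [/age_subP Si|Si]; last first.
  apply/age_subP => j nj; rewrite fcoef_basis.
  by case: eqP nj => // <-; rewrite Si.
apply: contraT => /Si; rewrite fcoef_basis eqxx => /eqP.
by rewrite oner_eq0.
Qed.

Lemma age_sub_gen a m :
  (affage_gen K a m \in age_sub) = age_sub_index (Some (a, m)).
Proof. exact: age_sub_basis. Qed.

Lemma age_sub_ind (P : affage K -> Prop) : P 0 ->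
  (forall c i x, age_sub_index i -> P x -> P (c *: affage_basis K i + x)) ->
  forall x, x \in age_sub -> P x.
Proof.
move=> P0 PD x /age_subP Sx.
pose trunc := lext (fun i =>
  if age_sub_index i then affage_basis K i else 0 : affage K).
have tP c j y : trunc (c *: affage_basis K j + y) =
    c *: (if age_sub_index j then affage_basis K j else 0) + trunc y.
  by rewrite /trunc linearP /= lext_basis.
have t0 : trunc 0 = 0 by rewrite /trunc linear0.
have tE i y : fcoef i (trunc y) = if age_sub_index i then fcoef i y else 0.
  elim/affage_ind: y => [|c j y IHy]; first by rewrite t0 linear0 if_same.
  rewrite tP !linearP /= IHy (fun_if (fcoef i)) linear0 fcoef_basis.
  by case: eqP => [->|_]; do ?case: ifP => _; rewrite ?mulr0 ?addr0.
have -> : x = trunc x.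
  by apply: freemodP => i; rewrite tE; case: ifPn => // /Sx.
elim/affage_ind: {Sx} x => [|c j y IHy]; first by rewrite t0.
rewrite tP; case: ifP => [jS|_]; first exact: PD.
by rewrite scaler0 add0r.
Qed.

Hypothesis hd : d2 <= d1 + d3.

Lemma age_sub_table i j : age_sub_index i -> age_sub_index j ->
  affage_table K i j \in age_sub.
Proof.
case: i => [[a m]|]; last by move=> _ _; exact: rpred0.
case: j => [[b n]|]; last by move=> _ _; exact: rpred0.
move=> hm hn /=; apply: rpredD; last first.
  by apply: rpredZ; rewrite (age_sub_basis None).
rewrite -[lie _ _]/(age_lie _ _) age_lie_gen.
case: a hm => hm; case: b hn => hn; rewrite /= ?linear0 ?linearN ?linearZ /=
  ?affage_loop_gen -?scaleN1r ?rpredZ ?rpred0 // ?age_sub_gen //=.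
all: first [ exact: le_trans hd (lerD hm hn)
  | by rewrite [m + n]addrC; exact: le_trans hd (lerD hn hm)
  | by rewrite -[X in X <= _]addr0; exact: lerD hm hn
  | by rewrite -[X in X <= _]add0r; exact: lerD hm hn ].
Qed.

Lemma age_sub_lie : lie_closed age_sub.
Proof.
move=> x y xS; move: x xS y; apply: (age_sub_ind
  (P := fun x => forall y, y \in age_sub -> lie x y \in age_sub)) =>
  [|c i x iS IHx] y yS.
  by rewrite (linear_0 (@lie_linearl K (affage K) y)) rpred0.
rewrite lie_linearl rpredD //; last exact: IHx.
apply: rpredZ; move: y yS {IHx}; apply: (age_sub_ind
  (P := fun y => lie (affage_basis K i) y \in age_sub)) => [|d j y jS IHy].
  by rewrite (linear_0 (@lie_linearr K (affage K) _)) rpred0.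
rewrite lie_linearr rpredD // rpredZ //.
rewrite -[lie _ _]/(affage_lie _ _) affage_lie_basis.
exact: age_sub_table.
Qed.

End AgeSubalgebra.

Notation affage_sub K hd := (subalg (@age_sub_lie K _ _ _ hd)).

Definition restricted (K : fieldType) (W : lieModType (affage K)) : Prop :=
  forall w : W, exists N : int, forall (a : age_basis) (m : int), N <= m ->
    lact (affage_gen K a m) w = 0.

(* Main.v *)
Require Import Defs.
From mathcomp Require Import all_boot all_order all_algebra.
From mathcomp Require Import boolp reals complex.
From HB Require Import structures.
From mathcomp Require Import zify.

Import Order.TTheory GRing.Theory Num.Theory.
Local Open Scope ring_scope.

(** The subalgebra, call it b, lacks the elements e_(d1-i), h_(-i), p_(d2-i) and
    q_(d3-i) for i > 0. Each of them has a partner in b that kills V, their bracket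
    being p_l up to sign:
<<
      [q_(l-d1+i), e_(d1-i)] = - p_l        [p_(l+i), h_(-i)] = - p_l
      [h_(l-d2+i), p_(d2-i)] =   p_l        [e_(l-d3+i), q_(d3-i)] = p_l
>>
    Since p_l is injective on V, a partner acts on products of the missing
    elements applied to V like p_l times a partial derivative. Repeated
    differentiation brings a nonzero vector of a submodule U down to a nonzero
    vector 1 (x) v. The vectors v with 1 (x) v in U form a submodule of V,
    which is therefore V, and V generates the induced module.

    The partners are not exactly derivatives, since they also have brackets with
    the other missing elements. The remedy is to treat the missing elements
    in a suitable order, as variables adjoined one at a time such that
    each partner kills what was built from the earlier variables. For the
    variables p_(d2-1), e_(d1-1), p_(d2-2), e_(d1-2), ... this works on the nose;
    afterwards q_(d3-1), h_(-1), q_(d3-2), h_(-2), ... are adjoined, and the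
    equations only hold up to terms with fewer factors h and q. Both cases are
    covered by the record [lowering]. The core is [euler_inj]: in characteristic 0
    the operator x D + (n + 1) P is injective whenever P is and [D, x] = P.
    From it follow [tower_ker] (a vector killed by the partner of a variable does
    not involve this variable) and [tower_descent].

    This argument expresses vectors of the induced module by products but never
    needs these expressions to be unique, except that 1 (x) v must be nonzero when
    v is. This is the Poincare-Birkhoff-Witt theorem relative to b, [pure1_inj].
    It is proved by letting the algebra act on words in the missing elements with
    values in V. Ordering these elements as p < e < q < h makes b together with
    any initial segment span a subalgebra ([age_flag_lie]), which keeps both the
    definition of the action and the proof of its commutation relations a plain
    induction on words.

    The module is restricted because the set of vectors killed by a_m for m
    large is a submodule, and it contains V. *)

Set Implicit Arguments.
Unset Strict Implicit.
Unset Printing Implicit Defensive.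

(** * Subspaces and spans *)

Section Subspaces.
Variables (K : fieldType) (V : lmodType K) (U : V -> Prop).
Hypothesis sU : is_subspace U.

Lemma subsp0 : U 0. Proof. by case: sU. Qed.
Lemma subspZD a u v : U u -> U v -> U (a *: u + v). Proof. by case: sU => _; apply. Qed.
Lemma subspZ a u : U u -> U (a *: u).
Proof. by move=> Uu; rewrite -[_ *: _]addr0; apply: subspZD => //; exact: subsp0. Qed.
Lemma subspD u v : U u -> U v -> U (u + v).
Proof. by move=> Uu; rewrite -[u in u + v]scale1r; exact: subspZD. Qed.
Lemma subspN u : U u -> U (- u).
Proof. by rewrite -scaleN1r; exact: subspZ. Qed.
Lemma subspB u v : U u -> U v -> U (u - v).
Proof. by move=> Uu Uv; apply: subspD => //; exact: subspN. Qed.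

Lemma subspDl u v : U u -> U (u + v) -> U v.
Proof. by move=> Uu /subspB/(_ Uu); rewrite addrC addKr. Qed.
Lemma subspDr u v : U v -> U (u + v) -> U u.
Proof. by rewrite addrC; exact: subspDl. Qed.
End Subspaces.

Section Span.
Variables (K : fieldType) (U V : lmodType K).

Lemma lspan_map (f : U -> V) (S : U -> Prop) (T : submodClosed V) : linear f ->
  (forall s, S s -> f s \in T) -> forall u, u \in lspan S -> f u \in T.
Proof.
move=> f_lin fS u /lspanP/(_ (fun u => f u \in T)); apply=> //; split.
  by rewrite (linear_0 f_lin) rpred0.
by move=> a x y xT yT; rewrite f_lin rpredD // rpredZ.
Qed.

Lemma lspan_eq (f g : U -> V) (S : U -> Prop) : linear f -> linear g ->
  (forall s, S s -> f s = g s) -> forall u, u \in lspan S -> f u = g u.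
Proof.
move=> f_lin g_lin fg u /lspanP/(_ (fun u => f u = g u)); apply=> //.
split=> [|c x y fx fy]; first by rewrite !linear_0.
by rewrite f_lin g_lin fx fy.
Qed.
End Span.

(** * Modules induced from a subalgebra *)

Lemma uea_act_linearl (K : fieldType) (L : lieAlgType K) (M : lieModType L) (m : M) :
  linear (fun u : uea L => uea_act u m).
Proof.
move=> a x y; have [u ->] := uea_pi_surj x; have [v ->] := uea_pi_surj y.
by rewrite uea_piZ -linearD /= !uea_actE linearP.
Qed.

Lemma uea_act_linearr (K : fieldType) (L : lieAlgType K) (M : lieModType L) (u : uea L) :
  linear (uea_act u : M -> M).
Proof.
by move=> a x y; have [w ->] := uea_pi_surj u; rewrite !uea_actE free_act_linear.
Qed.

Section Frobenius.
Variables (K : fieldType) (L : lieAlgType K) (S : submodClosed L).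
Variables (S_lie : lie_closed S) (V : lieModType (subalg S_lie)).
Variables (W : lieModType L) (j : {linear V -> W}).
Hypothesis j_act : forall (x : subalg S_lie) v, j (lact x v) = lact (val x) (j v).

Lemma uea_incl_act a v : uea_act (uea_incl a) (j v) = j (uea_act a v).
Proof.
have [w ->] := uea_pi_surj a; rewrite uea_actE.
have lin_in : linear (fun x : subalg S_lie => uea_in (val x)).
  by move=> c y z; rewrite linearP.
have lie_in (x y : subalg S_lie) : uea_in (val (lie x y)) =
    uea_in (val x) * uea_in (val y) - uea_in (val y) * uea_in (val x).
  exact: uea_in_lie.
rewrite /uea_incl (uea_liftE lin_in lie_in).
elim/freealg_ind: w => [|c s w IH].
  by rewrite !linear0 (linear_0 (uea_act_linearl _)).
rewrite !linearP /= uea_act_linearl IH; congr (_ *: _ + _).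
rewrite free_lift_word free_act_word {IH}.
elim: s => [|x s IHs] /=; first by rewrite big_nil uea_act1.
by rewrite big_cons uea_actM IHs uea_act_in j_act.
Qed.

(** The map u (x) v |-> u . j v kills the relations defining the tensor product,
    so a vector whose image under some equivariant j is nonzero survives in the
    induced module. *)
Lemma pure1_eq0 v : pure _ _ 1 v = 0 :> induced V -> j v = 0.
Proof.
pose phi := lext (fun p : uea L * V => uea_act p.1 (j p.2)).
move=> v0.
have /lpi_eq : tens_pi (@uea_incl K L S S_lie) (@uea_act K _ V) (pure0 1 v) =
    tens_pi _ _ 0 by rewrite linear0.
rewrite subr0 => Iv.
have phi0 : phi (pure0 1 v) = 0.
  apply: (lspan_ker (f := phi) _ Iv) => _ [c b b' n|c b n n'|b a n].
  - rewrite linearB linearP /= /phi !lext_basis /= uea_act_linearl.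
    exact: subrr.
  - rewrite linearB linearP /= /phi !lext_basis /= linearP uea_act_linearr.
    exact: subrr.
  - rewrite linearB /= /phi !lext_basis /= uea_actM uea_incl_act.
    exact: subrr.
by move: phi0; rewrite /phi lext_basis /= uea_act1.
Qed.
End Frobenius.

Section InducedGenerated.
Variables (K : fieldType) (L : lieAlgType K) (S : submodClosed L).
Variables (S_lie : lie_closed S) (V : lieModType (subalg S_lie)).

Definition ind_unit (v : V) : induced V := pure _ _ 1 v.

Lemma ind_unit_linear : linear ind_unit.
Proof. exact: pure_linearr. Qed.

Lemma ind_unit_act (y : subalg S_lie) v :
  lact (val y) (ind_unit v) = ind_unit (lact y v).
Proof.
rewrite -[LHS]/(tens_lmul _ _) tens_lmul_pure mulr1 -[uea_in _]mul1r.
by rewrite -uea_incl_in pure_balanced uea_act_in.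
Qed.

(** U(g) is spanned by words, whose letters are peeled off one at a time. *)
Lemma induced_gen (Q : induced V -> Prop) : is_subspace Q ->
  (forall (x : L) w, Q w -> Q (lact x w)) -> (forall v, Q (ind_unit v)) ->
  forall w, Q w.
Proof.
move=> Q_sub Q_act Q_unit; apply: tens_ind => [|b v t Qt]; first exact: (subsp0 Q_sub).
apply: (subspD Q_sub) => //; have [u ->] := uea_pi_surj b.
elim/freealg_ind: u => [|c s u IH].
  rewrite linear0 (linear_0 (pure_linearl _ _ v)); exact: (subsp0 Q_sub).
rewrite linearP pure_linearl; apply: (subspZD Q_sub) => // {c u IH}.
elim: s => [|x s IH]; first exact: Q_unit.
suff -> : pure _ _ (uea_pi (word K (x :: s))) v =
    lact x (pure _ _ (uea_pi (word K s)) v : induced V) by exact: Q_act.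
by rewrite -[RHS]/(tens_lmul _ _) tens_lmul_pure uea_piM word_cat.
Qed.
End InducedGenerated.

(** * Words with coefficients in a vector space *)

Section WordTensor.
Variables (K : fieldType) (B : choiceType) (V : lmodType K).

(** The vector space of finite formal sums of words with coefficients in V: the
    tensor product over K of the free algebra with V, obtained from the general
    balanced construction by balancing over the empty set. *)
Definition wtens : Type :=
  tens (of_void (freealg K B)) (fun (_ : void) (v : V) => v).

HB.instance Definition _ := GRing.Lmodule.on wtens.

Definition wpure (w : seq B) (v : V) : wtens := pure _ _ (word K w) v.

Lemma wpure_linear w : linear (wpure w).
Proof. exact: pure_linearr. Qed.

HB.instance Definition _ w :=
  GRing.isLinear.Build K V wtens *:%R (wpure w) (wpure_linear w).

Lemma wtens_ind (P : wtens -> Prop) :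
  P 0 -> (forall w v t, P t -> P (wpure w v + t)) -> forall t, P t.
Proof.
move=> P0 PD; apply: tens_ind => // b v t.
elim/freealg_ind: b t => [|c w u IH] t Pt.
  by rewrite (linear_0 (pure_linearl _ _ v)) add0r.
rewrite pure_linearl -addrA.
have -> : c *: pure (of_void (freealg K B)) (fun (_ : void) (v : V) => v)
    (word K w) v = wpure w (c *: v) by rewrite linearZ.
by apply: PD; exact: IH.
Qed.

Definition wcons (b : B) : wtens -> wtens := @tens_lmul _ _ _ _ _ _ (word K [:: b]).

Lemma wcons_linear b : linear (wcons b).
Proof. exact: tens_lmul_linearr. Qed.

HB.instance Definition _ b :=
  GRing.isLinear.Build K wtens wtens *:%R (wcons b) (wcons_linear b).

Lemma wcons_pure b w v : wcons b (wpure w v) = wpure (b :: w) v.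
Proof. by rewrite /wcons tens_lmul_pure word_cat. Qed.

Section Lift.
Variables (M : lmodType K) (f : seq B -> {linear V -> M}).

Definition wlift0 := lext (fun p : freealg K B * V => lext (fun w => f w p.2) p.1).

HB.instance Definition _ := GRing.Linear.on wlift0.

Definition wlift : wtens -> M := lquot_lift wlift0.

Lemma wliftE u : wlift (tens_pi _ _ u) = wlift0 u.
Proof.
apply: (lquot_liftE (f := wlift0)); apply: lspan_ker => _ [c b b' v|c b v v'|b []].
- rewrite linearB linearP /= /wlift0 !lext_basis /= linearP; exact: subrr.
- rewrite linearB linearP /= /wlift0 !lext_basis /=.
  rewrite -lext_linear_fun; apply/eqP; rewrite subr_eq0; apply/eqP.
  by congr (lext _ b); apply/funext => w; rewrite linearP.
Qed.

Lemma wlift_linear : linear wlift.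
Proof.
move=> c s t; have [u ->] := tens_pi_surj s; have [v ->] := tens_pi_surj t.
by rewrite -linearP !wliftE linearP.
Qed.

HB.instance Definition _ :=
  GRing.isLinear.Build K wtens M *:%R wlift wlift_linear.

Lemma wlift_pure w v : wlift (wpure w v) = f w v.
Proof. by rewrite wliftE /wlift0 lext_basis /= lext_basis. Qed.

End Lift.

(** The properties of V-valued words that the construction below relies on;
    stating them as an existence keeps it independent of the model. *)
Lemma word_tensor_exists : exists (M : lmodType K)
    (pw : seq B -> {linear V -> M}) (cons : B -> {linear M -> M})
    (lift : (seq B -> {linear V -> M}) -> {linear M -> M})
    (proj : {linear M -> V}),
  [/\ forall P : M -> Prop, P 0 ->
        (forall w v t, P t -> P (pw w v + t)) -> forall t, P t,
      forall b w v, cons b (pw w v) = pw (b :: w) v,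
      forall f w v, lift f (pw w v) = f w v &
      forall v, proj (pw [::] v) = v].
Proof.
pose nil_proj (w : seq B) : {linear V -> V} := if w is [::] then idfun else \0.
exists wtens, (fun w => wpure w : {linear V -> wtens}),
  (fun b => wcons b : {linear wtens -> wtens}),
  (fun f => wlift f : {linear wtens -> wtens}),
  (wlift nil_proj : {linear wtens -> V}); split.
- exact: wtens_ind.
- exact: wcons_pure.
- by move=> f w v; rewrite [LHS]wlift_pure.
- by move=> v; rewrite [LHS]wlift_pure.
Qed.

End WordTensor.

(** * The Poincare-Birkhoff-Witt theorem relative to a subalgebra *)

Section RelativePBW.
Variables (K : fieldType) (L : lieAlgType K) (B : choiceType).
Variables (e : B -> L) (crd : {linear L -> freemod K B}).
Hypothesis crd_e : forall b, crd (e b) = fbasis b.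
Hypothesis crdK : forall x, lext e (crd x) = x.
Variables (N : pred B) (le : rel B).
Hypothesis le_total : total le.
Hypothesis le_trans : transitive le.
Hypothesis le_anti : antisymmetric le.
Variables (S : submodClosed L) (S_lie : lie_closed S).
Variable V : lieModType (subalg S_lie).
Hypothesis S_basis : forall b, ~~ N b -> e b \in S.
Hypothesis S_span : forall x, x \in S ->
  x \in lspan (fun y => exists2 b, ~~ N b & y = e b).

Definition below k b := ~~ N b || le b k.
Definition flag k : L -> Prop := fun x => exists2 b, below k b & x = e b.
(* The subalgebra together with an initial segment of the complement spans a
   subalgebra; by [pbw_act_upto] this keeps the action below from producing
   letters larger than those already present. *)
Hypothesis flag_lie : forall k i j, N k -> below k i -> below k j ->
  lie (e i) (e j) \in lspan (flag k).

Lemma lieC (x y : L) : lie x y = - lie y x.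
Proof.
have lD := (bracketDl (@lie_linearl _ L), bracketDr (@lie_linearr _ L)).
apply/eqP; rewrite -addr_eq0; apply/eqP.
by have := liexx (x + y); rewrite !lD !liexx add0r addr0.
Qed.

Lemma crd_ind (P : L -> Prop) :
  P 0 -> (forall c b x, P x -> P (c *: e b + x)) -> forall x, P x.
Proof.
move=> P0 PD x; rewrite -[x]crdK; move: (crd x).
elim/freemod_ind => [|c b u IH]; first by rewrite linear0.
by rewrite linearP /= lext_basis; exact: PD.
Qed.

(** Total version of the action of the subalgebra on V, equal to 0 outside. *)
Definition sub_act (x : L) (v : V) : V := lact (insubd (0 : subalg S_lie) x) v.

Lemma sub_act_linear x : linear (sub_act x).
Proof. exact: lact_linearr. Qed.

Lemma sub_act_val (y : subalg S_lie) v : sub_act (val y) v = lact y v.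
Proof. by rewrite /sub_act valKd. Qed.

Variables (M : lmodType K) (pw : seq B -> {linear V -> M}).
Variables (prep : B -> {linear M -> M}).
Variables (lift : (seq B -> {linear V -> M}) -> {linear M -> M}).
Hypothesis M_ind : forall P : M -> Prop,
  P 0 -> (forall w v t, P t -> P (pw w v + t)) -> forall t, P t.
Hypothesis prep_pw : forall b w v, prep b (pw w v) = pw (b :: w) v.
Hypothesis lift_pw : forall f w v, lift f (pw w v) = f w v.

(** The action of x on the word [w] applied to [v], by moving a letter to the
    right past [j] at the cost of the bracket with [j], until it can be prepended
    or acts on [v]. Recursion on [w] alone suffices: by the flag property the
    words occurring in [pbw w' v (e i)] have letters at most [j], so letting [j]
    act on them is the same as prepending it. *)
Fixpoint pbw (w : seq B) (v : V) (x : L) : M :=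
  match w with
  | [::] => lext (fun i =>
      if N i then pw [:: i] v else pw [::] (sub_act (e i) v)) (crd x)
  | j :: w' => lext (fun i =>
      if N i && le j i then pw (i :: w) v
      else prep j (pbw w' v (e i)) + pbw w' v (lie (e i) (e j))) (crd x)
  end.

Lemma pbw_linear w v : linear (pbw w v).
Proof. by case: w => [|j w] c x y; rewrite /= (linearP crd) lext_is_linear. Qed.

Lemma pbw0 w v : pbw w v 0 = 0.
Proof. exact: linear_0 (pbw_linear w v). Qed.

Lemma pbw_e_nil v i : pbw [::] v (e i) =
  if N i then pw [:: i] v else pw [::] (sub_act (e i) v).
Proof. by rewrite /= crd_e lext_basis. Qed.

Lemma pbw_e_cons j w v i : pbw (j :: w) v (e i) =
  if N i && le j i then pw (i :: j :: w) v
  else prep j (pbw w v (e i)) + pbw w v (lie (e i) (e j)).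
Proof. by rewrite [LHS]/= crd_e lext_basis. Qed.

Lemma pbw_linearv w x : linear (fun v => pbw w v x).
Proof.
elim: w x => [|j w IH] x c v v'; elim/crd_ind: x => [|d i x IHx];
  rewrite ?pbw0 ?scaler0 ?addr0 // !pbw_linear IHx.
all: rewrite scalerDr !scalerA [c * d]mulrC -!scalerA addrACA -!scalerDr.
all: congr (_ *: _ + _); rewrite ?pbw_e_nil ?pbw_e_cons; case: ifP => _.
- by rewrite linearP.
- by rewrite sub_act_linear linearP.
- by rewrite linearP.
- have {}IH y : pbw w (c *: v + v') y = c *: pbw w v y + pbw w v' y := IH y c v v'.
  by rewrite !IH linearP scalerDr -!addrA; congr (_ + _); rewrite addrCA.
Qed.

Definition ordrev : rel B := fun i j => le j i.
Definition std_word (w : seq B) := all N w && sorted ordrev w.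

(** The junk words, which are not decreasing words in the complement, span a
    direct summand on which the algebra is made to act trivially. *)
Definition pbw_std (x : L) (w : seq B) (v : V) : M :=
  if std_word w then pbw w v x else 0.

Lemma pbw_std_linear x w : linear (pbw_std x w).
Proof.
move=> c v v'; rewrite /pbw_std; case: ifP => _; first exact: pbw_linearv.
by rewrite scaler0 addr0.
Qed.

HB.instance Definition _ x w :=
  GRing.isLinear.Build K V M *:%R (pbw_std x w) (pbw_std_linear x w).

Definition pbw_act (x : L) : M -> M := lift (pbw_std x).

HB.instance Definition _ x := GRing.Linear.on (pbw_act x).

Lemma pbw_act_pw x w v : pbw_act x (pw w v) = if std_word w then pbw w v x else 0.
Proof. by rewrite /pbw_act lift_pw. Qed.

Lemma pbw_act_linearl m : linear (pbw_act^~ m).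
Proof.
move=> c x y; elim/M_ind: m => [|w v m IH].
  by rewrite !linear0 addr0.
rewrite !linearD /= !pbw_act_pw IH.
rewrite addrACA; congr (_ + _).
by case: ifP => _; [exact: pbw_linear|rewrite scaler0 addr0].
Qed.

Lemma pbw_act0 m : pbw_act 0 m = 0.
Proof. exact: linear_0 (pbw_act_linearl m). Qed.

Lemma pbw_actN x m : pbw_act (- x) m = - pbw_act x m.
Proof.
by have := pbw_act_linearl m (-1) x 0; rewrite pbw_act0 !addr0 !scaleN1r.
Qed.

Lemma std_word_cons k w : std_word (k :: w) = [&& N k, all (le^~ k) w & std_word w].
Proof.
rewrite /std_word /= (path_sortedE (_ : transitive ordrev)).
  by rewrite -/(ordrev k) -!andbA; do !bool_congr.
by move=> y x z /= xy yz; exact: le_trans yz xy.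
Qed.

Definition upto k : M -> Prop := fun m =>
  exists w v, [/\ std_word w, all (le^~ k) w & m = pw w v].

Lemma prep_upto j k m : N j -> le j k ->
  m \in lspan (upto j) -> prep j m \in lspan (upto k).
Proof.
move=> Nj jk; apply: (lspan_map (f := prep j) (linearP (prep j))) => _ [w [v [ws wj ->]]].
apply: mem_lspan; exists (j :: w), v.
rewrite prep_pw std_word_cons Nj wj ws /= jk; split => //.
by apply: sub_all wj => i /le_trans; apply.
Qed.

Lemma uptoS j k m : le j k -> m \in lspan (upto j) -> m \in lspan (upto k).
Proof.
move=> jk; apply: (lspan_map (f := id) (fun _ _ _ => erefl)) => _ [w [v [ws wj ->]]].
apply: mem_lspan; exists w, v; split => //.
by apply: sub_all wj => i /le_trans; apply.
Qed.

Lemma below_flag k b : below k b -> e b \in lspan (flag k).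
Proof. by move=> kb; apply: mem_lspan; exists b. Qed.

Lemma belowxx k : below k k.
Proof. by rewrite /below; case/orP: (le_total k k) => ->; rewrite orbT. Qed.

Lemma pbw_upto w v k x : std_word w -> N k -> all (le^~ k) w ->
  x \in lspan (flag k) -> pbw w v x \in lspan (upto k).
Proof.
elim: w k x => [|j w IH] k x ws Nk wk;
  apply: (lspan_map (pbw_linear _ _)) => _ [i ki ->].
  rewrite pbw_e_nil; case: ifPn => [Ni|_]; last first.
    by apply: mem_lspan; exists [::], (sub_act (e i) v).
  apply: mem_lspan; exists [:: i], v; split=> //; first by rewrite std_word_cons Ni.
  by move: ki; rewrite /below Ni /= andbT.
rewrite pbw_e_cons; move: ws wk; rewrite std_word_cons /=.
move=> /and3P[Nj wj ws] /andP[jk wk].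
case: ifPn => [/andP[Ni ji]|nij].
  have ik : le i k by move: ki; rewrite /below Ni.
  apply: mem_lspan; exists [:: i, j & w], v; split => //=; last first.
    by rewrite ik jk.
  rewrite !std_word_cons Ni Nj wj ws /= ji /= andbT.
  by apply: sub_all wj => i' /le_trans; apply.
have ij : below j i.
  by rewrite /below; case/nandP: nij => [->//|/negPf ji];
    case/orP: (le_total i j) ji => -> //; rewrite ?orbT.
apply: rpredD.
  by apply: (prep_upto Nj jk); apply: IH => //; exact: below_flag.
apply: (uptoS jk); apply: IH => //.
by apply: flag_lie => //; exact: belowxx.
Qed.

Lemma pbw_act_upto k x m : N k -> x \in lspan (flag k) ->
  m \in lspan (upto k) -> pbw_act x m \in lspan (upto k).
Proof.
move=> Nk xk; apply: (lspan_map (f := pbw_act x) (linearP (pbw_act x)))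
  => _ [w [v [ws wk ->]]].
by rewrite pbw_act_pw ws; exact: pbw_upto.
Qed.

Lemma pbw_act_top k m : N k -> m \in lspan (upto k) ->
  pbw_act (e k) m = prep k m.
Proof.
move=> Nk; apply: (lspan_eq (f := pbw_act (e k)) (g := prep k)
  (linearP (pbw_act (e k))) (linearP (prep k))) => _ [w [v [ws wk ->]]].
rewrite prep_pw [LHS]pbw_act_pw ws; case: w ws wk => [|j w] ws.
  by move=> _; rewrite pbw_e_nil Nk.
by move=> /andP[jk _]; rewrite pbw_e_cons Nk jk.
Qed.

Definition pbw_comm x y m := pbw_act x (pbw_act y m) =
  pbw_act y (pbw_act x m) + pbw_act (lie x y) m.

Lemma pbw_comm_subspacem x y : is_subspace (pbw_comm x y).
Proof.
split=> [|c m m'] ; rewrite /pbw_comm ?linear0 ?addr0 // !linearP /= => -> ->.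
by rewrite scalerDr addrACA.
Qed.

Lemma pbw_comm_subspacel y m : is_subspace (fun x => pbw_comm x y m).
Proof.
split=> [|c x x']; rewrite /pbw_comm.
  by rewrite (linear_0 (@lie_linearl _ _ y)) !pbw_act0 linear0 addr0.
rewrite lie_linearl !pbw_act_linearl linearP /= => -> ->.
by rewrite scalerDr addrACA.
Qed.

Lemma pbw_comm_sym x y m : pbw_comm x y m -> pbw_comm y x m.
Proof.
by rewrite /pbw_comm => ->; rewrite (lieC y x) pbw_actN addrK.
Qed.

(** For the largest letter [k] the commutation relation is the recursive clause
    defining the action. *)
Lemma pbw_comm_top k x m : N k -> x \in lspan (flag k) ->
  m \in lspan (upto k) -> pbw_comm x (e k) m.
Proof.
move=> Nk xk /lspanP/(_ (pbw_comm x (e k))); apply; first exact: pbw_comm_subspacem.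
move=> _ [w [v [ws wk ->]]].
move: xk => /lspanP/(_ (fun x => pbw_comm x (e k) (pw w v))); apply.
  exact: pbw_comm_subspacel.
move=> _ [i ik ->]; rewrite /pbw_comm.
have wM : pw w v \in lspan (upto k) by apply: mem_lspan; exists w, v.
have kw : std_word (k :: w) by rewrite std_word_cons Nk wk ws.
rewrite (pbw_act_top Nk wM) prep_pw pbw_act_pw kw pbw_e_cons.
case: ifPn => [/andP[Ni ki]|_].
  have -> : i = k.
    by apply: le_anti; rewrite ki andbT; move: ik; rewrite /below Ni.
  rewrite liexx pbw_act0 addr0 (pbw_act_top Nk wM) prep_pw pbw_act_pw kw.
  by rewrite pbw_e_cons Nk; case/orP: (le_total k k) => ->.
rewrite !pbw_act_pw ws (pbw_act_top Nk) //.
by apply: pbw_upto => //; exact: below_flag.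
Qed.

Lemma pbw_act_sub x v : x \in S -> pbw_act x (pw [::] v) = pw [::] (sub_act x v).
Proof.
move=> xS; suff : x \in S /\ pbw_act x (pw [::] v) = pw [::] (sub_act x v).
  by case.
move: (S_span xS) => /lspanP/(_ (fun x => x \in S /\
  pbw_act x (pw [::] v) = pw [::] (sub_act x v))); apply.
  have vE y (yS : y \in S) : sub_act y v = lact (Sub y yS : subalg S_lie) v.
    by rewrite -sub_act_val.
  split=> [|c y z [yS yE] [zS zE]].
    rewrite rpred0 pbw_act0 (vE 0 (rpred0 S)); split => //.
    have -> : Sub 0 (rpred0 S) = 0 :> subalg S_lie by exact: val_inj.
    by rewrite (linear_0 (@lact_linearl _ _ V v)) linear0.
  have czS : c *: y + z \in S by rewrite rpredD // rpredZ.
  split=> //; rewrite pbw_act_linearl yE zE (vE _ czS) (vE _ yS) (vE _ zS).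
  have -> : Sub (c *: y + z) czS = c *: Sub y yS + Sub z zS :> subalg S_lie.
    by apply: val_inj.
  by rewrite lact_linearl linearP.
move=> _ [b Nb ->]; split; first exact: S_basis.
by rewrite pbw_act_pw pbw_e_nil (negPf Nb).
Qed.

(** The defect of commutation of x and y on the word k :: w, with x and y below
    [k], is by the Jacobi identity a combination of defects on the shorter word
    [w] of the pairs (x, y), ([x, k], y) and (x, [y, k]). If x or y is not below
    [k], the larger of the two dominates the word and [pbw_comm_top] applies. On
    the empty word, two elements of the subalgebra act as they do on V. *)
Lemma pbw_comm_all x y m : pbw_comm x y m.
Proof.
suff H w v : std_word w -> forall x y, pbw_comm x y (pw w v).
  elim/M_ind: m => [|w v m IH]; first by case: (pbw_comm_subspacem x y).
  apply: (subspD (pbw_comm_subspacem x y)) => //.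
  case: (boolP (std_word w)) => [/H//|/negPf ws].
  by rewrite /pbw_comm !pbw_act_pw !ws !linear0 addr0.
move=> {x y m}.
have bilin u : (forall i j, pbw_comm (e i) (e j) u) ->
    forall x y, pbw_comm x y u.
  move=> H x y.
  elim/crd_ind: x => [|c i x IHx]; first by case: (pbw_comm_subspacel y u).
  apply: (subspZD (pbw_comm_subspacel _ _)) IHx => //; apply: pbw_comm_sym.
  elim/crd_ind: y => [|d j y IHy]; first by case: (pbw_comm_subspacel (e i) u).
  apply: (subspZD (pbw_comm_subspacel _ _)) IHy => //; exact: H.
have top a b u : N a -> below a b -> std_word u -> all (le^~ a) u ->
    pbw_comm (e b) (e a) (pw u v).
  move=> Na ab us ua; apply: pbw_comm_top => //; first exact: below_flag.
  by apply: mem_lspan; exists u, v.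
have top2 a b u : N a -> std_word u -> all (le^~ a) u ->
    pbw_comm (e a) (e b) (pw u v).
  move=> Na us ua; case: (boolP (below a b)) => [ab|].
    by apply: pbw_comm_sym; exact: top.
  rewrite /below negb_or negbK => /andP[Nb nba].
  have ab : le a b by case/orP: (le_total a b) nba => // ->.
  by apply: top => //; [rewrite /below ab orbT|apply: sub_all ua => ? /le_trans; apply].
elim: w => [|k w IH] ws; apply: bilin => i j.
  have [Ni|Ni] := boolP (N i); first exact: top2.
  have [Nj|Nj] := boolP (N j); first by apply: pbw_comm_sym; exact: top2.
  have iS := S_basis Ni; have jS := S_basis Nj.
  rewrite /pbw_comm !(pbw_act_sub, S_lie) // -linearD; congr (pw [::] _).
  pose a := Sub (e i) iS : subalg S_lie; pose b := Sub (e j) jS : subalg S_lie.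
  rewrite -[e i]/(val a) -[e j]/(val b) -[lie (val a) (val b)]/(val (lie a b)).
  by rewrite !sub_act_val lact_lie addrC subrK.
have [/andP[Ni ki]|nki] := boolP (N i && le k i).
  apply: top2 => //; rewrite /= ki.
  by move: ws; rewrite std_word_cons => /and3P[_ wk _]; apply: sub_all wk => ? /le_trans; apply.
have [/andP[Nj kj]|nkj] := boolP (N j && le k j).
  apply/pbw_comm_sym/top2 => //; rewrite /= kj.
  by move: ws; rewrite std_word_cons => /and3P[_ wk _]; apply: sub_all wk => ? /le_trans; apply.
have bel b : ~~ (N b && le k b) -> below k b.
  rewrite negb_and /below => /orP[-> //|nkb].
  by case/orP: (le_total k b) nkb => -> //; rewrite orbT.
move: ws; rewrite std_word_cons => /and3P[Nk wk ws].
set m := pw w v.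
have mk : m \in lspan (upto k) by apply: mem_lspan; exists w, v.
have -> : pw (k :: w) v = pbw_act (e k) m by rewrite pbw_act_top // prep_pw.
have ik := below_flag (bel _ nki); have jk := below_flag (bel _ nkj).
have ikk : lie (e i) (e k) \in lspan (flag k) by apply: flag_lie; rewrite ?belowxx ?bel.
have jkk : lie (e j) (e k) \in lspan (flag k) by apply: flag_lie; rewrite ?belowxx ?bel.
have ijk : lie (e i) (e j) \in lspan (flag k) by apply: flag_lie; rewrite ?bel.
have IHm := IH ws : forall a b, pbw_comm a b m.
have C a n : a \in lspan (flag k) -> n \in lspan (upto k) -> pbw_act a (pbw_act (e k) n) =
   pbw_act (e k) (pbw_act a n) + pbw_act (lie a (e k)) n.
  by move=> ? ?; exact: pbw_comm_top.
rewrite /pbw_comm (C _ _ jk mk) (C _ _ ik mk) (C _ _ ijk mk) !linearD /=.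
rewrite (C _ _ ik) ?pbw_act_upto // (C _ _ jk) ?pbw_act_upto //.
rewrite (IHm (e i) (e j)) (IHm (e i) (lie _ _)) (IHm (lie (e i) (e k)) (e j)).
rewrite linearD /=.
have -> : lie (lie (e i) (e j)) (e k) = lie (e i) (lie (e j) (e k))
  - lie (e j) (lie (e i) (e k)).
  by rewrite lie_jacobi addrK.
rewrite (lieC (lie (e i) (e k))) pbw_actN.
have actB y z : pbw_act (y - z) m = pbw_act y m - pbw_act z m.
  by rewrite -[y]scale1r pbw_act_linearl pbw_actN !scale1r.
rewrite actB.
by rewrite !addrA [LHS](ACl (1*5*3*2*6*4)).
Qed.

Definition pbw_mod : Type := M.
HB.instance Definition _ := GRing.Lmodule.on pbw_mod.

Lemma pbw_act_lie x y (m : pbw_mod) :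
  pbw_act (lie x y) m = pbw_act x (pbw_act y m) - pbw_act y (pbw_act x m).
Proof. by rewrite (pbw_comm_all x y m) addrC addrA addNr add0r. Qed.

HB.instance Definition _ := Lmodule_isLieModule.Build K L pbw_mod
  pbw_act_linearl (fun x => linearP (pbw_act x)) pbw_act_lie.

Variable proj : {linear M -> V}.
Hypothesis proj_nil : forall v, proj (pw [::] v) = v.

(** The injectivity half of the Poincare-Birkhoff-Witt theorem relative to a
    subalgebra: the module of words contains a copy of V, the words of length 0,
    on which the subalgebra acts as it does on V. *)
Lemma pure1_inj v : pure _ _ 1 v = 0 :> induced V -> v = 0.
Proof.
pose j : {linear V -> pbw_mod} := pw [::].
have j_act (x : subalg S_lie) u : j (lact x u) = lact (val x) (j u).
  by rewrite [RHS](pbw_act_sub u (valP x)) (sub_act_val x u).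
by move=> /(pure1_eq0 j_act) /(congr1 proj); rewrite proj_nil linear0.
Qed.

End RelativePBW.

(** * The flag of subalgebras of the affine ageing algebra *)

Section AgeFlag.
Local Notation idx := (option (age_basis * int)).

(** The order p < e < q < h on the complement of the subalgebra, refined by
    decreasing power of t, since brackets with the subalgebra that stay within
    one of the four types raise this power. As [e, q] yields p, which may again
    lie in the complement, p precedes e and q. The brackets of a negative h with
    e, p and q lower the power of t without bound, so that h comes last. *)
Definition age_rank (i : idx) : nat :=
  match i with
  | None => 0 | Some (gen_z, _) => 1 | Some (gen_p, _) => 2
  | Some (gen_e, _) => 3 | Some (gen_q, _) => 4 | Some (gen_h, _) => 5
  end.

Definition age_deg (i : idx) : int := if i is Some (_, m) then m else 0.

Definition age_le : rel idx := fun i j =>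
  (age_rank i < age_rank j)%N ||
  ((age_rank i == age_rank j) && (age_deg j <= age_deg i)).

Lemma age_le_total : total age_le.
Proof. by move=> i j; rewrite /age_le; lia. Qed.

Lemma age_le_trans : transitive age_le.
Proof. by move=> i j k; rewrite /age_le; lia. Qed.

Lemma age_le_anti : antisymmetric age_le.
Proof.
move=> i j ij.
have /andP[/eqP rE /eqP dE] : (age_rank i == age_rank j) && (age_deg i == age_deg j).
  by move: ij; rewrite /age_le; lia.
by case: i j {ij} rE dE => [[[] m]|] [[[] n]|] //= _ ->.
Qed.

Variables (K : fieldType) (d1 d2 d3 : int) (hd : d2 <= d1 + d3).

Let N i := ~~ age_sub_index d1 d2 d3 i.

Lemma age_flag_lie k i j : N k -> below N age_le k i -> below N age_le k j ->
  lie (affage_basis K i) (affage_basis K j) \in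
    lspan (flag (affage_basis K) N age_le k).
Proof.
have gen a m : below N age_le k (Some (a, m)) ->
    affage_gen K a m \in lspan (flag (affage_basis K) N age_le k).
  by move=> ?; apply: mem_lspan; exists (Some (a, m)).
move=> Nk ik jk; rewrite -[lie _ _]/(affage_lie _ _) affage_lie_basis.
case: i ik => [[a m]|] ik /=; last exact: rpred0.
case: j jk => [[b n]|] jk; last exact: rpred0.
apply: rpredD; last first.
  by apply: rpredZ; apply: mem_lspan; exists None => //; rewrite /below /N.
rewrite -[lie _ _]/(age_lie _ _) age_lie_gen.
case: k gen Nk ik jk => [[c r]|//].
case: c => gen; case: a; case: b; rewrite /below /N /age_le /= => Nk ik jk;
  rewrite ?linear0 ?linearN ?linearZ /= ?affage_loop_gen -?scaleN1r ?rpredZ ?rpred0 //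
    ?gen // /below /N /age_le /=; move: ik jk Nk hd; lia.
Qed.

End AgeFlag.

Section AgeInduced.
Variables (K : fieldType) (d1 d2 d3 : int) (hd : d2 <= d1 + d3).
Variable V : lieModType (affage_sub K hd).

Let idx : choiceType := option (age_basis * int).
Let crd : {linear affage K -> freemod K idx} := idfun.

(** This is what makes the induced module nonzero. *)
Lemma induced_unit_inj (v : V) : pure _ _ 1 v = 0 :> induced V -> v = 0.
Proof.
have crd_e b : crd (affage_basis K b) = fbasis b by [].
have crdK x : lext (affage_basis K) (crd x) = x.
  elim/affage_ind: x => [|c i x IH]; first by rewrite linear0.
  by rewrite linearP /= IH lext_basis.
pose N (i : idx) := ~~ age_sub_index d1 d2 d3 i.
have S_basis i : ~~ N i -> affage_basis K i \in age_sub d1 d2 d3.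
  by rewrite negbK => si; rewrite age_sub_basis.
have S_span x : x \in @age_sub K d1 d2 d3 ->
    x \in lspan (fun y => exists2 b, ~~ N b & y = affage_basis K b).
  move: x; apply: age_sub_ind => [|c i x si IH]; first exact: rpred0.
  by apply: rpredD => //; apply/rpredZ/mem_lspan; exists i; rewrite ?negbK.
have [M [pw [cons [lift [proj [M_ind consE liftE projE]]]]]] :=
  word_tensor_exists idx V.
exact: (pure1_inj crd_e crdK age_le_total age_le_trans age_le_anti S_basis
  S_span (age_flag_lie K hd) M_ind consE liftE projE).
Qed.
End AgeInduced.

(** * Towers of variables with lowering operators *)

Section Adjoin.
Variables (K : fieldType) (W : lmodType K).

(** Polynomials in [x] with coefficients in [T], of total degree [c] when [T c]
    is thought of as the part of degree [c]. *)
Fixpoint adjoin (x : W -> W) (T : nat -> W -> Prop) (c : nat) : W -> Prop :=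
  match c with
  | 0 => T 0
  | c'.+1 => fun w => exists t t', [/\ T c t, adjoin x T c' t' & w = t + x t']
  end.

Fixpoint tower (x : nat -> W -> W) (T : nat -> W -> Prop) (J : nat) :
    nat -> W -> Prop :=
  if J is J'.+1 then adjoin (x J') (tower x T J') else T.

(** One variable [x] is adjoined to [T], and [D] plays the role of P d/dx: it kills
    [T], and [D, x] = P. All this holds modulo the negligible part [N], which
    the grading shifts along. *)
Section Step.
Variables (x D P : {linear W -> W}) (N T : nat -> W -> Prop).
Hypothesis nat_neq0 : forall n, n.+1%:R != 0 :> K.
Hypothesis N_sub : forall c, is_subspace (N c).
Hypothesis T_sub : forall c, is_subspace (T c).
Hypothesis NT : forall c w, N c w -> T c w.
Hypothesis PT : forall c w, T c w -> T c (P w).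
Hypothesis P_inj : forall c w, T c w -> N c (P w) -> N c w.
Hypothesis xN : forall c w, N c w -> N c.+1 (x w).
Hypothesis DN : forall c w, N c.+1 w -> N c (D w).
Hypothesis Dx : forall w, D (x w) = x (D w) + P w.
Hypothesis DT0 : forall w, T 0 w -> D w = 0.
Hypothesis DT : forall c w, T c.+1 w -> N c (D w).
Local Notation T' := (adjoin x T).
Hypothesis Px : forall c w, T' c w -> N c.+1 (P (x w) - x (P w)).
Hypothesis DP : forall c w, T' c.+1 w -> N c (D (P w) - P (D w)).

Lemma adjoin0 c : T' c 0.
Proof.
elim: c => [|c IH]; first exact: (subsp0 (T_sub _)).
by exists 0, 0; rewrite linear0 addr0; split=> //; exact: (subsp0 (T_sub _)).
Qed.

Lemma sub_adjoin c w : T c w -> T' c w.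
Proof.
case: c => // c Tw; exists w, 0; rewrite linear0 addr0.
by split=> //; exact: adjoin0.
Qed.

Lemma adjoin_sub c : is_subspace (T' c).
Proof.
elim: c => [|c IH]; first exact: T_sub.
split; first by apply: sub_adjoin; exact: (subsp0 (T_sub _)).
move=> a _ _ [t [t' [Tt Tt' ->]]] [s [s' [Ts Ts' ->]]].
exists (a *: t + s), (a *: t' + s').
split; [exact: (subspZD (T_sub _))|exact: (subspZD IH)|].
by rewrite linearP scalerDr addrACA.
Qed.

Lemma N_adjoin c w : N c w -> T' c w.
Proof. by move/NT; exact: sub_adjoin. Qed.

Lemma x_adjoin c w : T' c w -> T' c.+1 (x w).
Proof. by exists 0, w; rewrite add0r; split=> //; exact: (subsp0 (T_sub _)). Qed.

Lemma P_adjoin c w : T' c w -> T' c (P w).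
Proof.
elim: c w => [|c IH] w; first exact: PT.
move=> [t [t' [Tt Tt' ->]]]; rewrite linearD; apply: (subspD (adjoin_sub _)).
  exact/sub_adjoin/PT.
rewrite -[P (x t')](subrK (x (P t'))); apply: (subspD (adjoin_sub _)).
  exact/N_adjoin/Px.
exact/x_adjoin/IH.
Qed.

Lemma D_adjoin c w : T' c.+1 w -> T' c (D w).
Proof.
elim: c w => [|c IH] _ [t [t' [Tt Tt' ->]]]; rewrite linearD Dx;
  apply: (subspD (adjoin_sub _)); rewrite ?(DT0 Tt') ?linear0 ?add0r;
  try exact/N_adjoin/DT.
  exact: PT.
by apply: (subspD (adjoin_sub _)); [exact/x_adjoin/IH|exact: P_adjoin].
Qed.

(** On x^k t the operator x D is k P, so x D + (n + 1) P acts on each power of [x]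
    by a positive multiple of the injective operator [P]. Raising n in the statement
    absorbs the degree of w in [x]: on x t the operator with parameter n is x
    applied to the operator with parameter n + 1 on t. *)
Lemma euler_inj c n w : T' c w -> N c (x (D w) + n.+1%:R *: P w) -> N c w.
Proof.
have xD0 s : T 0 s -> x (D s) = 0 by move=> /DT0 ->; rewrite linear0.
have NPn c' m s : T c' s -> N c' (m.+1%:R *: P s) -> N c' s.
  move=> Ts /(subspZ (N_sub _) (m.+1%:R^-1)); rewrite scalerA mulVf //.
  by rewrite scale1r; exact: P_inj.
elim: c n w => [|c IH] n w Tw; first by rewrite xD0 // add0r; exact: NPn.
have [s [t [Ts Tt wE]]] := Tw.
have NxDs : N c.+1 (x (D s)) by exact/xN/DT.
pose y := x (D t) + n.+2%:R *: P t.
have -> : x (D w) + n.+1%:R *: P w =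
    x (D s) + n.+1%:R *: (P (x t) - x (P t)) + (n.+1%:R *: P s + x y).
  have -> : x y = x (x (D t)) + (n.+1%:R *: x (P t) + x (P t)).
    by rewrite /y linearD linearZ /= -[n.+2%:R]natr1 scalerDl scale1r.
  rewrite wE !linearD Dx linearD /= scalerN.
  rewrite -!addrA; congr (_ + _); rewrite !addrA.
  by rewrite [RHS](ACl (4*6*3*1*5*2)) /= addrK.
have NPx : N c.+1 (n.+1%:R *: (P (x t) - x (P t))).
  by apply: (subspZ (N_sub _)); exact: Px.
move/(subspDl (N_sub _) (subspD (N_sub _) NxDs NPx)) => Nw.
have Ty : T' c y.
  apply: (subspD (adjoin_sub _)); last exact/(subspZ (adjoin_sub _))/P_adjoin.
  case: (c) t Tt {y NxDs NPx wE Nw Tw} => [|c'] t Tt.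
    by rewrite xD0 //; exact: (subsp0 (adjoin_sub _)).
  exact/x_adjoin/D_adjoin.
(* The two summands of [Nw] are separated by [D], which kills the first one. *)
have Ny : N c y.
  apply: (IH 0%N y Ty); rewrite scale1r -Dx.
  have: N c (D (n.+1%:R *: P s + x y)) by exact: DN.
  rewrite linearD; apply: (subspDl (N_sub _)); rewrite linearZ /=.
  apply/(subspZ (N_sub _))/DT; exact: PT.
have Nt : N c t by exact: (IH n.+1).
have Ns : N c.+1 s.
  apply: (NPn _ n) => //; apply: (subspDr (N_sub _)) Nw; exact: xN.
by rewrite wE; apply: (subspD (N_sub _)) => //; exact: xN.
Qed.

(** As d/dx in characteristic 0: what [D] kills is constant in [x]. *)
Lemma ker_adjoin c w : T' c.+1 w -> N c (D w) -> T c.+1 w.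
Proof.
move=> [t [t' [Tt Tt' ->]]].
rewrite linearD => /(subspDl (N_sub _) (DT Tt)); rewrite Dx -[P t']scale1r.
move=> /(euler_inj (n := 0) Tt') Nt'.
by apply: (subspD (T_sub _)) => //; exact/NT/xN.
Qed.

Lemma adjoin_P_inj c w : T' c w -> N c (P w) -> N c w.
Proof.
elim: c w => [|c IH] w Tw; first exact: P_inj.
move=> NPw; have := DN NPw.
rewrite -[D (P w)](subrK (P (D w))) => /(subspDl (N_sub _) (DP Tw)).
move/(IH _ (D_adjoin Tw)) => NDw.
have Tw' := ker_adjoin Tw NDw; exact: P_inj.
Qed.

End Step.

Section Tower.
Variables (x : nat -> {linear W -> W}) (N T0 : nat -> W -> Prop).
Local Notation T := (tower (fun J => x J) T0).
Hypothesis N_sub : forall c, is_subspace (N c).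
Hypothesis T0_sub : forall c, is_subspace (T0 c).
Hypothesis NT0 : forall c w, N c w -> T0 c w.
Hypothesis xN : forall J c w, N c w -> N c.+1 (x J w).

Lemma tower_sub J c : is_subspace (T J c).
Proof. by elim: J c => [|J IH] c; [exact: T0_sub|exact: adjoin_sub]. Qed.

Lemma N_tower J c w : N c w -> T J c w.
Proof.
move=> Nw; elim: J => [|J IH] /=; first exact: NT0.
by apply: sub_adjoin IH; exact: tower_sub.
Qed.

Lemma tower_mono J J' c w : (J <= J')%N -> T J c w -> T J' c w.
Proof.
move=> /subnK <-; elim: (J' - J)%N => [//|i IH] Tw.
by rewrite addSn; apply: sub_adjoin; [exact: tower_sub|exact: IH].
Qed.

Lemma tower_0 J w : T J 0 w -> T0 0 w.
Proof. by elim: J. Qed.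

(** To check that a lowering operator kills the earlier stages of a tower it is
    enough to compute its brackets with the earlier variables. *)
Lemma tower_kill (D' : {linear W -> W}) J :
  (forall w, T0 0 w -> D' w = 0) -> (forall c w, T0 c.+1 w -> N c (D' w)) ->
  (forall J' c w, (J' < J)%N -> T J'.+1 c w -> N c (D' (x J' w) - x J' (D' w))) ->
  forall c w, T J c.+1 w -> N c (D' w).
Proof.
move=> D0 D1; elim: J => [_|J IH] // comm.
have {}IH : forall c w, T J c.+1 w -> N c (D' w).
  by apply: IH => J' c w J'J; apply: comm; exact: ltnW.
elim=> [|c IHc] _ [t [t' [Tt Tt' ->]]]; rewrite linearD;
  apply: (subspD (N_sub _) (IH _ _ Tt)); rewrite -[D' _](subrK (x J (D' t')));
  apply: (subspD (N_sub _)); try exact: comm.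
- by rewrite (D0 t' (tower_0 Tt')) linear0; exact: (subsp0 (N_sub _)).
- exact/xN/IHc.
Qed.

(** The variables commute modulo the negligible part, so that they may be
    multiplied in any order. *)
Lemma tower_mul J K' c w : (K' < J)%N ->
  (forall J' c w, (K' < J' < J)%N -> T J'.+1 c w ->
    N c.+2 (x K' (x J' w) - x J' (x K' w))) ->
  T J c w -> T J c.+1 (x K' w).
Proof.
elim: J c w => // J IH c w; rewrite ltnS leq_eqVlt => /orP[/eqP ->|KJ] comm.
  by apply: x_adjoin; exact: tower_sub.
have {}IH c' w' : T J c' w' -> T J c'.+1 (x K' w').
  apply: IH => // J' c1 w1 /andP[? ?]; apply: comm; lia.
elim: c w => [|c IHc] w; first by move=> /IH ?; apply: sub_adjoin => //; exact: tower_sub.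
move=> [t [t' [Tt Tt' ->]]]; rewrite linearD.
apply: (subspD (tower_sub J.+1 _)).
  by apply: sub_adjoin; [exact: tower_sub|exact: IH].
rewrite -[x K' _](subrK (x J (x K' t'))); apply: (subspD (tower_sub J.+1 _)).
  by apply: N_tower; apply: comm => //; rewrite KJ leqnn.
by apply: x_adjoin; [exact: tower_sub|exact: IHc].
Qed.

End Tower.

Section Lowering.
Variables (x D : nat -> {linear W -> W}) (P : {linear W -> W}).
Variables (N T0 : nat -> W -> Prop).
Local Notation T := (tower (fun J => x J) T0).

(** The variables [x J] are adjoined one after the other to [T0], and [D J] lowers
    the degree in [x J] while killing everything built from earlier variables.
    There are two uses: with exact equations (N zero), and up to terms
    of lower degree for a filtration (N c the part of degree c - 1). *)
Record lowering : Prop := Lowering {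
  low_N_sub : forall c, is_subspace (N c);
  low_T0_sub : forall c, is_subspace (T0 c);
  low_NT0 : forall c w, N c w -> T0 c w;
  low_xN : forall J c w, N c w -> N c.+1 (x J w);
  low_DN : forall J c w, N c.+1 w -> N c (D J w);
  low_PT0 : forall c w, T0 c w -> T0 c (P w);
  low_P_inj : forall c w, T0 c w -> N c (P w) -> N c w;
  low_Dx : forall J w, D J (x J w) = x J (D J w) + P w;
  low_DT0 : forall J w, T0 0 w -> D J w = 0;
  low_DT : forall J c w, T J c.+1 w -> N c (D J w);
  low_Px : forall J c w, T J.+1 c w -> N c.+1 (P (x J w) - x J (P w));
  low_DP : forall J c w, T J.+1 c.+1 w -> N c (D J (P w) - P (D J w))
}.

Hypothesis nat_neq0 : forall n, n.+1%:R != 0 :> K.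
Hypothesis low : lowering.

Let N_sub := low_N_sub low.
Let T_sub J c : is_subspace (T J c) := tower_sub x (low_T0_sub low) J c.
Let NT J c w : N c w -> T J c w.
Proof. exact: N_tower (low_T0_sub low) (low_NT0 low) _ _ _. Qed.

Lemma tower_P J c w : T J c w -> T J c (P w).
Proof.
elim: J c w => [|J IH] c w; first exact: (low_PT0 low).
apply: (P_adjoin (N := N)); try by [].
all: first [ exact: T_sub | exact: NT | exact: (low_Px low) | exact: (low_Dx
  low) ].
Qed.

Lemma tower_D0 J w : T J 0 w -> D J w = 0.
Proof. by move=> /tower_0; exact: (low_DT0 low). Qed.

Lemma tower_P_inj J c w : T J c w -> N c (P w) -> N c w.
Proof.
elim: J c w => [|J IH] c w; first exact: (low_P_inj low).
apply: (adjoin_P_inj (x := x J) (D := D J)); try by [].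
all: first [ exact: T_sub | exact: NT | exact: tower_P | exact: (low_xN low) |
  exact: (low_DN low) | exact: tower_D0 | exact: (low_DT low) | exact: (low_Px
  low) | exact: (low_Dx low) | exact: (low_DP low) ].
Qed.

Lemma tower_ker J c w : T J.+1 c.+1 w -> N c (D J w) -> T J c.+1 w.
Proof.
apply: (ker_adjoin (P := P)); try by [].
all: first [ exact: T_sub | exact: NT | exact: tower_P | exact: tower_P_inj |
  exact: (low_xN low) | exact: (low_DN low) | exact: tower_D0 | exact: (low_DT
  low) | exact: (low_Px low) | exact: (low_Dx low) ].
Qed.

Lemma tower_D J c w : T J.+1 c.+1 w -> T J.+1 c (D J w).
Proof.
apply: (D_adjoin (P := P) (N := N)); try by [].
all: first [ exact: T_sub | exact: NT | exact: tower_P | exact: (low_xN low) |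
  exact: tower_D0 | exact: (low_DT low) | exact: (low_Px low) | exact: (low_Dx
  low) ].
Qed.

(** Every nonzero w is brought down to degree 0: if [D J] does not kill w it
    lowers its degree, and otherwise w does not involve the variable [x J]. *)
Lemma tower_descent (U : W -> Prop) : is_subspace U ->
  (forall J w, U w -> U (D J w)) ->
  (forall c w, T0 c.+1 w -> exists J, T J c w) ->
  forall c J w, T J c w -> U w -> w <> 0 -> exists u, [/\ T0 0 u, U u & u <> 0].
Proof.
move=> U_sub UD T0_union; elim=> [|c IHc] J w Tw Uw w0.
  by exists w; split=> //; exact: tower_0 Tw.
elim: J Tw => [|J IHJ] Tw; first by have [J Tw'] := T0_union _ _ Tw; exact: IHc Tw' Uw w0.
have [DJ0|DJ0] := eqVneq (D J w) 0; last first.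
  by apply: (IHc _ _ (tower_D Tw)); [exact: UD|exact/eqP].
by apply: IHJ; apply: tower_ker => //; rewrite DJ0; exact: (subsp0 (N_sub _)).
Qed.

End Lowering.
End Adjoin.

Section Filt.
Variables (K : fieldType) (W : lmodType K) (U0 : W -> Prop) (x : nat -> {linear W -> W}).

(** The filtration by the number of factors [x J]. *)
Inductive filt : nat -> W -> Prop :=
| filt_base c w : U0 w -> filt c w
| filt_lin c a u v : filt c u -> filt c v -> filt c (a *: u + v)
| filt_mul c J w : filt c w -> filt c.+1 (x J w).

Hypothesis U0_sub : is_subspace U0.

Lemma filt_sub c : is_subspace (filt c).
Proof.
by split=> [|a u v]; [exact/filt_base/(subsp0 U0_sub)|exact: filt_lin].
Qed.

Lemma filtS c w : filt c w -> filt c.+1 w.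
Proof.
elim=> {c w} [c w Uw|c a u v _ IHu _ IHv|c J w _ IH]; first exact: filt_base.
  exact: filt_lin.
exact: filt_mul.
Qed.

Lemma filt_mono c c' w : (c <= c')%N -> filt c w -> filt c' w.
Proof.
by move=> /subnK <- Fw; elim: (c' - c)%N => [//|i IH]; rewrite addSn; exact: filtS.
Qed.

Variables (N T0 : nat -> W -> Prop).
Local Notation T := (tower (fun J => x J) T0).

Lemma tower_filt J c w : (forall c w, T0 c w -> filt c w) -> T J c w -> filt c w.
Proof.
move=> T0F; elim: J c w => [|J IH] c w; first exact: T0F.
elim: c w => [|c IHc] w; first exact: IH.
move=> [t [t' [Tt Tt' ->]]]; apply: (subspD (filt_sub _)); first exact: IH.
exact/filt_mul/IHc.
Qed.

(** A product of the [x J] in arbitrary order lies in the tower, whose elements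
    are ordered products. *)
Lemma filt_tower c w :
  (forall c, is_subspace (T0 c)) -> (forall c w, N c w -> T0 c w) ->
  (forall c w, U0 w -> T0 c w) ->
  (forall I J c w, T J.+1 c w -> N c.+2 (x I (x J w) - x J (x I w))) ->
  filt c w -> exists J, T J c w.
Proof.
move=> T0_sub NT0 UT0 comm; elim=> {c w} [c w Uw|c a u v _ [J Tu] _ [J' Tv]|c J w _ [J' Tw]].
- by exists 0%N; exact: UT0.
- exists (maxn J J'); apply: (subspZD (tower_sub x T0_sub _ _)).
  + by apply: tower_mono Tu => //; exact: leq_maxl.
  + by apply: tower_mono Tv => //; exact: leq_maxr.
- exists (maxn J.+1 J'); apply: (tower_mul (N := N)) => //; first exact: leq_maxl.
    by move=> I c' u _; exact: comm.
  by apply: tower_mono Tw => //; exact: leq_maxr.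
Qed.
End Filt.

(** * Commutation relations of the affine ageing algebra *)

Section Operators.
Variables (K : fieldType) (W : lmodType K).
Variables (g : age_basis -> int -> {linear W -> W}) (k : {linear W -> W}).
Implicit Types (m n : int) (w : W).

(** Lowering only uses the operators by which the basis elements act and their
    commutation relations. *)
Record age_rep : Prop := AgeRep {
  pp_comm : forall m n w, g gen_p m (g gen_p n w) = g gen_p n (g gen_p m w);
  pe_comm : forall m n w, g gen_p m (g gen_e n w) = g gen_e n (g gen_p m w);
  ee_comm : forall m n w, g gen_e m (g gen_e n w) = g gen_e n (g gen_e m w);
  qq_comm : forall m n w, g gen_q m (g gen_q n w) = g gen_q n (g gen_q m w);
  pq_comm : forall m n w,
    g gen_p m (g gen_q n w) = g gen_q n (g gen_p m w) + g gen_z (m + n) w;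
  eq_comm : forall m n w,
    g gen_e m (g gen_q n w) = g gen_q n (g gen_e m w) + g gen_p (m + n) w;
  he_comm : forall m n w,
    g gen_h m (g gen_e n w) = g gen_e n (g gen_h m w) + 2 *: g gen_e (m + n) w;
  hp_comm : forall m n w,
    g gen_h m (g gen_p n w) = g gen_p n (g gen_h m w) + g gen_p (m + n) w;
  hq_comm : forall m n w,
    g gen_h m (g gen_q n w) = g gen_q n (g gen_h m w) - g gen_q (m + n) w;
  hh_comm : forall m n w,
    g gen_h m (g gen_h n w) = g gen_h n (g gen_h m w) + (m%:~R * (m + n == 0)%:R) *: k w;
  z_comm : forall a m n w, g gen_z m (g a n w) = g a n (g gen_z m w);
  k_comm : forall a n w, k (g a n w) = g a n (k w)
}.

Hypothesis rep : age_rep.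

Lemma ep_comm m n w : g gen_e m (g gen_p n w) = g gen_p n (g gen_e m w).
Proof. by rewrite (pe_comm rep). Qed.
Lemma qp_comm m n w :
  g gen_q m (g gen_p n w) = g gen_p n (g gen_q m w) - g gen_z (m + n) w.
Proof. by rewrite (pq_comm rep) [n + m]addrC addrK. Qed.
Lemma qe_comm m n w :
  g gen_q m (g gen_e n w) = g gen_e n (g gen_q m w) - g gen_p (m + n) w.
Proof. by rewrite (eq_comm rep) [n + m]addrC addrK. Qed.
Lemma eh_comm m n w :
  g gen_e m (g gen_h n w) = g gen_h n (g gen_e m w) - 2 *: g gen_e (m + n) w.
Proof. by rewrite (he_comm rep) [n + m]addrC addrK. Qed.
Lemma ph_comm m n w :
  g gen_p m (g gen_h n w) = g gen_h n (g gen_p m w) - g gen_p (m + n) w.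
Proof. by rewrite (hp_comm rep) [n + m]addrC addrK. Qed.
Lemma qh_comm m n w :
  g gen_q m (g gen_h n w) = g gen_h n (g gen_q m w) + g gen_q (m + n) w.
Proof. by rewrite (hq_comm rep) [n + m]addrC addrNK. Qed.

End Operators.

Section Commutation.
Variables (K : fieldType) (W : lieModType (affage K)).
Implicit Types (m n : int) (w : W).

Local Notation act a m := (lact (affage_gen K a m)).

Lemma lact0l w : lact (0 : affage K) w = 0.
Proof. exact: linear_0 (lact_linearl w). Qed.

Lemma lactZl c (x : affage K) w : lact (c *: x) w = c *: lact x w.
Proof. by have := lact_linearl w c x 0; rewrite lact0l !addr0. Qed.

Lemma lactDl (x y : affage K) w : lact (x + y) w = lact x w + lact y w.
Proof. by have := lact_linearl w 1 x y; rewrite !scale1r. Qed.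

Lemma lactNl (x : affage K) w : lact (- x) w = - lact x w.
Proof. by rewrite -scaleN1r lactZl scaleN1r. Qed.

Lemma lact_comm (x y : affage K) w :
  lact x (lact y w) = lact y (lact x w) + lact (lie x y) w.
Proof. by rewrite lact_lie addrC subrK. Qed.

Lemma lie_gen a b m n : lie (affage_gen K a m) (affage_gen K b n) =
  affage_loop (m + n) (age_table (age_gen K) a b) +
  (m%:~R * ((gen_h == a)%:R * (gen_h == b)%:R) * (m + n == 0)%:R) *: affage_k K.
Proof.
rewrite -[LHS]/(affage_lie (affage_basis K (Some (a, m))) (affage_basis K (Some (b, n)))).
rewrite affage_lie_basis /affage_table /age_form !fcoef_basis.
by rewrite -[lie _ _]/(age_lie _ _) age_lie_gen ![gen_h == _]eq_sym.
Qed.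

Lemma act_comm a b m n w : act a m (act b n w) =
  act b n (act a m w) + lact (affage_loop (m + n) (age_table (age_gen K) a b)) w +
  (m%:~R * ((gen_h == a)%:R * (gen_h == b)%:R) * (m + n == 0)%:R) *: lact (affage_k K) w.
Proof. by rewrite lact_comm lie_gen lactDl lactZl addrA. Qed.

Ltac expand_comm := rewrite act_comm /=; rewrite ?linear0 ?linearN ?linearZ /= ?affage_loop_gen
  ?lact0l ?lactNl ?lactZl ?(mul0r, mulr0) ?scale0r ?addr0 ?lactNl.

Lemma affage_rep :
  @age_rep K W (fun a m => lact (affage_gen K a m)) (lact (affage_k K)).
Proof.
split=> /=.
- by move=> m n w; expand_comm.
- by move=> m n w; expand_comm.
- by move=> m n w; expand_comm.
- by move=> m n w; expand_comm.
- by move=> m n w; expand_comm.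
- by move=> m n w; expand_comm.
- by move=> m n w; expand_comm.
- by move=> m n w; expand_comm.
- by move=> m n w; expand_comm.
- by move=> m n w; expand_comm; rewrite !mulr1.
- by move=> a m n w; case: a; expand_comm.
- by move=> a n w; rewrite lact_comm [lie _ _]affage_kl lact0l addr0.
Qed.

End Commutation.

(** * Lowering to the generating subspace *)

Section Stages.
Variables (K : fieldType) (d1 d2 d3 l : int).
Hypothesis nat_neq0 : forall n, n.+1%:R != 0 :> K.
Hypotheses (hd : d2 <= d1 + d3) (hl : d2 < l) (hl_mem : d1 + d3 <= l + 1).
Variables (W : lmodType K) (V0 : W -> Prop).
Variables (g : age_basis -> int -> {linear W -> W}) (k : {linear W -> W}).
Hypothesis rep : age_rep g k.
Implicit Types (m n : int) (w : W).
Hypothesis V0_sub : is_subspace V0.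
Hypothesis V0_g : forall a m w, age_sub_index d1 d2 d3 (Some (a, m)) -> V0 w ->
  V0 (g a m w).
Hypothesis V0_k : forall w, V0 w -> V0 (k w).
Hypothesis V0_gen : forall Q : W -> Prop, is_subspace Q ->
  (forall a m w, Q w -> Q (g a m w)) -> (forall w, Q w -> Q (k w)) ->
  (forall w, V0 w -> Q w) -> forall w, Q w.
Hypothesis p_inj : forall w, V0 w -> g gen_p l w = 0 -> w = 0.
Hypothesis p0 : forall m w, l < m -> V0 w -> g gen_p m w = 0.
Hypothesis zV0 : forall m w, l + d2 - d1 <= m -> V0 w -> g gen_z m w = 0.
Hypothesis e0 : forall m w, l - d3 < m -> V0 w -> g gen_e m w = 0.
Hypothesis q0 : forall m w, l - d1 < m -> V0 w -> g gen_q m w = 0.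
Hypothesis h0 : forall m w, l - d2 < m -> V0 w -> g gen_h m w = 0.

Let pp := pp_comm rep. Let pe := pe_comm rep. Let ep := ep_comm rep.
Let ee := ee_comm rep. Let qq := qq_comm rep. Let pq := pq_comm rep.
Let qp := qp_comm rep. Let eq_ := eq_comm rep. Let qe := qe_comm rep.
Let he := he_comm rep. Let eh := eh_comm rep. Let hp := hp_comm rep.
Let ph := ph_comm rep. Let hq := hq_comm rep. Let qh := qh_comm rep.
Let hh := hh_comm rep. Let zg := z_comm rep. Let kg := k_comm rep.

Lemma preim_subspace (f : {linear W -> W}) (Q : W -> Prop) : is_subspace Q ->
  is_subspace (fun w => Q (f w)).
Proof.
move=> Q_sub; split=> [|a u v Qu Qv]; first by rewrite linear0; exact: (subsp0 Q_sub).
by rewrite linearP; exact: (subspZD Q_sub).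
Qed.

Lemma ker_subspace (f : {linear W -> W}) : is_subspace (fun w : W => f w = 0).
Proof.
by split=> [|c u v fu fv]; rewrite ?linear0 // linearP /= fu fv scaler0 addr0.
Qed.

Lemma negE (f : {linear W -> W}) w : (\- f : {linear W -> W}) w = - f w.
Proof. by []. Qed.

(** The z_m are central, so those vanishing on the generating subspace [V0] vanish
    everywhere. *)
Lemma z0 m w : l + d2 - d1 <= m -> g gen_z m w = 0.
Proof.
move=> hm; move: w; apply: V0_gen => [|a n w zw|w zw|w]; last exact: zV0.
- exact: ker_subspace.
- by rewrite zg zw linear0.
- by rewrite -kg zw linear0.
Qed.

(** The variables adjoined to [V0] are, in this order, p_(d2-1), e_(d1-1), p_(d2-2),
    e_(d1-2) and so on; odd indices stand for e. The bracket of [ep_low J] with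
    the variable [ep_gen J] is p_l. With this interleaving the brackets of
    [ep_low J] with the earlier variables are e_m, p_m or z_m with m so large
    that they act by zero; adjoining first all p or all e would
    not achieve this. *)
Definition ep_gen (J : nat) : {linear W -> W} :=
  if odd J then g gen_e (d1 - (J./2)%:Z - 1) else g gen_p (d2 - (J./2)%:Z - 1).
Definition ep_low (J : nat) : {linear W -> W} :=
  if odd J then (\- g gen_q (l - d1 + (J./2)%:Z + 1) : {linear W -> W})
  else g gen_h (l - d2 + (J./2)%:Z + 1).

Local Notation F2 := (filt V0 ep_gen).
(** The span of the products of p and e applied to [V0]. *)
Definition epV w := exists c, F2 c w.

Lemma epV_sub : is_subspace epV.
Proof.
split=> [|a u v [c Fu] [c' Fv]]; first by exists 0%N; exact/filt_base/(subsp0 V0_sub).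
by exists (maxn c c'); apply: filt_lin; [apply: filt_mono Fu => //; exact: leq_maxl
  |apply: filt_mono Fv => //; exact: leq_maxr].
Qed.

Lemma V0_epV w : V0 w -> epV w.
Proof. by exists 0%N; exact: filt_base. Qed.

Lemma epV_mul J w : epV w -> epV (ep_gen J w).
Proof. by move=> [c Fw]; exists c.+1; apply: filt_mul. Qed.

Lemma epV_ind (Q : W -> Prop) : is_subspace Q -> (forall w, V0 w -> Q w) ->
  (forall m w, epV w -> Q w -> Q (g gen_p m w)) ->
  (forall m w, epV w -> Q w -> Q (g gen_e m w)) ->
  forall w, epV w -> Q w.
Proof.
move=> Q_sub QV Qp Qe w [c]; elim=> {c w} [c w Vw|c a u v _ Qu _ Qv|c J w Fw Qw].
- exact: QV.
- exact: (subspZD Q_sub).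
- have Ew : epV w by exists c.
  by rewrite /= /ep_gen; case: ifP => _; [exact: Qe|exact: Qp].
Qed.

Lemma epV_p m w : epV w -> epV (g gen_p m w).
Proof.
have [hm|hm] := ltP m d2.
  have [i ->] : exists i : nat, m = d2 - i%:Z - 1.
    by exists (absz (d2 - 1 - m)%R); lia.
  by move/(epV_mul i.*2); rewrite /ep_gen odd_double doubleK.
move=> [c]; elim=> {c w} [c w Vw|c a u v _ Qu _ Qv|c J w _ Qw].
- exact/V0_epV/V0_g.
- by rewrite linearP; exact: (subspZD epV_sub).
- have := epV_mul J Qw; rewrite /ep_gen; case: ifP => _; first by rewrite pe.
  by rewrite pp.
Qed.

Lemma epV_e m w : epV w -> epV (g gen_e m w).
Proof.
have [hm|hm] := ltP m d1.
  have [i ->] : exists i : nat, m = d1 - i%:Z - 1.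
    by exists (absz (d1 - 1 - m)%R); lia.
  by move/(epV_mul i.*2.+1); rewrite /ep_gen /= odd_double uphalf_double.
move=> [c]; elim=> {c w} [c w Vw|c a u v _ Qu _ Qv|c J w _ Qw].
- exact/V0_epV/V0_g.
- by rewrite linearP; exact: (subspZD epV_sub).
- have := epV_mul J Qw; rewrite /ep_gen; case: ifP => _; first by rewrite ee.
  by rewrite ep.
Qed.

Lemma epV_z m w : epV w -> epV (g gen_z m w).
Proof.
move: w; apply: epV_ind => [|w Vw|n w _ Qw|n w _ Qw];
  first exact: preim_subspace epV_sub.
- exact/V0_epV/V0_g.
- by rewrite zg; exact: epV_p.
- by rewrite zg; exact: epV_e.
Qed.

Lemma epV_k w : epV w -> epV (k w).
Proof.
move: w; apply: epV_ind => [|w Vw|n w _ Qw|n w _ Qw];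
  first exact: preim_subspace epV_sub.
- exact/V0_epV/V0_k.
- by rewrite kg; exact: epV_p.
- by rewrite kg; exact: epV_e.
Qed.

Lemma epV_q m w : d3 <= m -> epV w -> epV (g gen_q m w).
Proof.
move=> hm; move: w; apply: epV_ind => [|w Vw|n w Ew Qw|n w Ew Qw];
  first exact: preim_subspace epV_sub.
- exact/V0_epV/V0_g.
- by rewrite qp; apply: (subspB epV_sub); [exact: epV_p|exact: epV_z].
- by rewrite qe; apply: (subspB epV_sub); [exact: epV_e|exact: epV_p].
Qed.

Lemma epV_h m w : 0 <= m -> epV w -> epV (g gen_h m w).
Proof.
move=> hm; move: w; apply: epV_ind => [|w Vw|n w Ew Qw|n w Ew Qw];
  first exact: preim_subspace epV_sub.
- exact/V0_epV/V0_g.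
- by rewrite hp; apply: (subspD epV_sub); exact: epV_p.
- rewrite he; apply: (subspD epV_sub); first exact: epV_e.
  by apply: (subspZ epV_sub); exact: epV_e.
Qed.

Lemma epV_p0 m w : l < m -> epV w -> g gen_p m w = 0.
Proof.
move=> hm; move: w; apply: epV_ind => [|w Vw|n w _ Qw|n w _ Qw].
- exact: ker_subspace.
- exact: p0.
- by rewrite pp Qw linear0.
- by rewrite pe Qw linear0.
Qed.

Lemma epV_e0 m w : l - d3 < m -> epV w -> g gen_e m w = 0.
Proof.
move=> hm; move: w; apply: epV_ind => [|w Vw|n w _ Qw|n w _ Qw].
- exact: ker_subspace.
- exact: e0.
- by rewrite ep Qw linear0.
- by rewrite ee Qw linear0.
Qed.

Let N2 (c : nat) (w : W) : Prop := w = 0.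
Let V2 (c : nat) : W -> Prop := V0.
Let P : {linear W -> W} := g gen_p l.
Local Notation T2 := (tower (fun J => ep_gen J) V2).

Lemma ep_tower_epV J c w : T2 J c w -> epV w.
Proof.
move=> Tw; exists c; apply: (tower_filt (x := ep_gen)) Tw => // c' u.
exact: filt_base.
Qed.

Lemma odd_halfE J : J = (odd J + J./2.*2)%N.
Proof. by rewrite odd_double_half. Qed.

Lemma ep_low_comm J w : ep_low J (ep_gen J w) = ep_gen J (ep_low J w) + P w.
Proof.
rewrite /P /ep_low /ep_gen; case: ifP => _.
  rewrite !negE qe linearN opprB addrC.
  by congr (_ + g _ _ w); lia.
by rewrite hp; congr (_ + g _ _ w); lia.
Qed.

Lemma ep_low_kill J c w : T2 J c.+1 w -> ep_low J w = 0.
Proof.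
apply: (tower_kill (N := N2)) => [c'|J' c' u|u Vu|c' u Vu|J' c' u J'J].
- by split=> // a u v -> ->; rewrite scaler0 addr0.
- by rewrite /N2 => ->; rewrite linear0.
- rewrite /ep_low; case: ifP => _; rewrite ?negE ?q0 ?h0 ?oppr0 //; lia.
- rewrite /N2 /ep_low; case: ifP => _; rewrite ?negE ?q0 ?h0 ?oppr0 //; lia.
move/ep_tower_epV => Eu.
have := odd_halfE J; have := odd_halfE J'; move: J'J.
rewrite /N2 /ep_low /ep_gen.
case: (odd J); case: (odd J') => J'J J'E JE.
- rewrite !negE qe linearN opprB opprK addrNK epV_p0 //; lia.
- rewrite !negE qp linearN opprB opprK addrNK z0 //; lia.
- rewrite he addrAC subrr add0r epV_e0 ?scaler0 //; lia.
- rewrite hp addrAC subrr add0r epV_p0 //; lia.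
Qed.

Lemma ep_lowering : lowering ep_gen ep_low P N2 V2.
Proof.
have N2_sub c : is_subspace (N2 c).
  by split=> // a u v -> ->; rewrite scaler0 addr0.
split=> //.
- by move=> c w ->; exact: (subsp0 V0_sub).
- by move=> J c w; rewrite /N2 => ->; rewrite linear0.
- by move=> J c w; rewrite /N2 => ->; rewrite linear0.
- by move=> c w; apply: V0_g; exact: ltW.
- exact: ep_low_comm.
- move=> J w Vw; rewrite /ep_low; case: ifP => _; rewrite ?negE ?q0 ?h0 ?oppr0 //; lia.
- exact: ep_low_kill.
- move=> J c w _; rewrite /N2 /P /ep_gen; case: ifP => _.
    by rewrite pe subrr.
  by rewrite pp subrr.
- move=> J c w /ep_tower_epV Ew; rewrite /N2 /P /ep_low; case: ifP => _.
    rewrite !negE qp linearN opprB opprK addrNK z0 //; lia.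
  rewrite hp addrAC subrr add0r epV_p0 //; lia.
Qed.

Lemma epV_tower w : epV w -> exists c J, T2 J c w.
Proof.
move=> [c Fw]; exists c; apply: (filt_tower (N := N2) (U0 := V0)) Fw => //.
- by move=> c' u ->; exact: (subsp0 V0_sub).
- move=> I J c' u _; rewrite /N2 /ep_gen.
  by case: ifP => _; case: ifP => _; [rewrite ee|rewrite ep|rewrite pe|rewrite pp];
    rewrite subrr.
Qed.

Lemma epV_p_inj w : epV w -> g gen_p l w = 0 -> w = 0.
Proof.
by move=> /epV_tower[c [J Tw]]; exact: (tower_P_inj nat_neq0 ep_lowering Tw).
Qed.

Lemma epV_descent (U : W -> Prop) : is_subspace U ->
  (forall a m w, U w -> U (g a m w)) ->
  forall w, epV w -> U w -> w <> 0 -> exists u, [/\ V0 u, U u & u <> 0].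
Proof.
move=> U_sub U_g w /epV_tower[c [J Tw]].
apply: (tower_descent nat_neq0 ep_lowering U_sub) Tw => [J' u Uu|c' u].
  rewrite /ep_low; case: ifP => _; last exact: U_g.
  by rewrite negE; apply: (subspN U_sub); exact: U_g.
by exists 0%N.
Qed.

(** The variables q_(d3-1), h_(-1), q_(d3-2), h_(-2) and so on are adjoined to
    [epV]; odd indices stand for h. Iterated brackets of [hq_low J] with several
    h are not small, but each bracket uses up one factor, so they are negligible
    for the filtration [F] by the number of factors h and q. *)
Definition hq_gen (J : nat) : {linear W -> W} :=
  if odd J then g gen_h (- (J./2)%:Z - 1) else g gen_q (d3 - (J./2)%:Z - 1).
Definition hq_low (J : nat) : {linear W -> W} :=
  if odd J then (\- g gen_p (l + (J./2)%:Z + 1) : {linear W -> W})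
  else g gen_e (l - d3 + (J./2)%:Z + 1).

Local Notation F := (filt epV hq_gen).
Let N1 (c : nat) : W -> Prop := if c is c'.+1 then F c' else fun w => w = 0.
Let V1 (c : nat) : W -> Prop := if c is c'.+1 then F c' else epV.
Local Notation T1 := (tower (fun J => hq_gen J) V1).

Let F_sub c : is_subspace (F c) := filt_sub hq_gen epV_sub c.

Let N1_sub c : is_subspace (N1 c).
Proof.
case: c => [|c]; last exact: F_sub.
by split=> // a u v -> ->; rewrite scaler0 addr0.
Qed.

Lemma F_gen_ind (Q : nat -> W -> Prop) : (forall c, is_subspace (Q c)) ->
  (forall c w, epV w -> Q c w) ->
  (forall c m w, F c w -> Q c w -> m < 0 -> Q c.+1 (g gen_h m w)) ->
  (forall c m w, F c w -> Q c w -> m < d3 -> Q c.+1 (g gen_q m w)) ->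
  forall c w, F c w -> Q c w.
Proof.
move=> Q_sub QV Qh Qq c w; elim=> {c w} [c w Vw|c a u v _ Qu _ Qv|c J w Fw Qw].
- exact: QV.
- exact: (subspZD (Q_sub _)).
- by rewrite /= /hq_gen; case: ifP => _; [apply: Qh|apply: Qq] => //; lia.
Qed.

Lemma F_h c m w : m < 0 -> F c w -> F c.+1 (g gen_h m w).
Proof.
move=> hm; have [i ->] : exists i : nat, m = - i%:Z - 1.
  by exists (absz (- 1 - m)%R); lia.
move/(filt_mul (x := hq_gen) i.*2.+1).
by rewrite /hq_gen /= odd_double uphalf_double.
Qed.

Lemma F_q c m w : m < d3 -> F c w -> F c.+1 (g gen_q m w).
Proof.
move=> hm; have [i ->] : exists i : nat, m = d3 - i%:Z - 1.
  by exists (absz (d3 - 1 - m)%R); lia.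
by move/(filt_mul (x := hq_gen) i.*2); rewrite /hq_gen odd_double doubleK.
Qed.

Let preF (f : {linear W -> W}) c : is_subspace (fun w => F c (f w)) :=
  preim_subspace f (F_sub c).

Lemma F_k c w : F c w -> F c (k w).
Proof.
move: c w; apply: F_gen_ind => [c|c w Ew|c n w Fw Qw hn|c n w Fw Qw hn]; first exact: preF.
- exact/filt_base/epV_k.
- by rewrite kg; exact: F_h.
- by rewrite kg; exact: F_q.
Qed.

Lemma F_z c m w : F c w -> F c (g gen_z m w).
Proof.
move: c w; apply: F_gen_ind => [c|c w Ew|c n w Fw Qw hn|c n w Fw Qw hn]; first exact: preF.
- exact/filt_base/epV_z.
- by rewrite zg; exact: F_h.
- by rewrite zg; exact: F_q.
Qed.

Let FS c w : F c w -> F c.+1 w := @filtS _ _ _ hq_gen c w.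

Lemma F_p c m w : F c w -> F c (g gen_p m w).
Proof.
move=> Fw; move: c w Fw m.
apply: F_gen_ind => [c|c w Ew m|c n w Fw Qw hn m|c n w Fw Qw hn m].
- split=> [m|a u v Qu Qv m]; first by rewrite linear0; exact: (subsp0 (F_sub _)).
  by rewrite linearP; apply: (subspZD (F_sub _)).
- exact/filt_base/epV_p.
- by rewrite ph; apply: (subspB (F_sub _)); [exact: F_h|exact/FS].
- by rewrite pq; apply: (subspD (F_sub _)); [exact: F_q|exact/FS/F_z].
Qed.

Lemma F_e c m w : F c w -> F c (g gen_e m w).
Proof.
move=> Fw; move: c w Fw m.
apply: F_gen_ind => [c|c w Ew m|c n w Fw Qw hn m|c n w Fw Qw hn m].
- split=> [m|a u v Qu Qv m]; first by rewrite linear0; exact: (subsp0 (F_sub _)).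
  by rewrite linearP; apply: (subspZD (F_sub _)).
- exact/filt_base/epV_e.
- rewrite eh; apply: (subspB (F_sub _)); first exact: F_h.
  exact/FS/(subspZ (F_sub _)).
- by rewrite eq_; apply: (subspD (F_sub _)); [exact: F_q|exact/FS/F_p].
Qed.

Lemma F_q_all c m w : F c w -> F c.+1 (g gen_q m w).
Proof.
move=> Fw; move: c w Fw m.
apply: F_gen_ind => [c|c w Ew m|c n w Fw Qw hn m|c n w Fw Qw hn m].
- split=> [m|a u v Qu Qv m]; first by rewrite linear0; exact: (subsp0 (F_sub _)).
  by rewrite linearP; apply: (subspZD (F_sub _)).
- have [hm|hm] := ltP m d3; first by apply: F_q => //; exact: filt_base.
  by apply: filt_base; exact: epV_q.
- by rewrite qh; apply: (subspD (F_sub _)); [exact: F_h|exact/FS].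
- by rewrite qq; exact: F_q.
Qed.

Lemma F_h_all c m w : F c w -> F c.+1 (g gen_h m w).
Proof.
move=> Fw; move: c w Fw m.
apply: F_gen_ind => [c|c w Ew m|c n w Fw Qw hn m|c n w Fw Qw hn m].
- split=> [m|a u v Qu Qv m]; first by rewrite linear0; exact: (subsp0 (F_sub _)).
  by rewrite linearP; apply: (subspZD (F_sub _)).
- have [hm|hm] := ltP m 0; first by apply: F_h => //; exact: filt_base.
  by apply: filt_base; exact: epV_h.
- rewrite hh; apply: (subspD (F_sub _)); first exact: F_h.
  exact/FS/FS/(subspZ (F_sub _))/F_k.
- by rewrite hq; apply: (subspB (F_sub _)); [exact: F_q|exact/FS/F_q_all].
Qed.

(** The span of all products of h and q applied to [epV] is stable under the whole
    algebra. *)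
Lemma F_exhaust w : exists c, F c w.
Proof.
move: w; apply: V0_gen => [|a m w [c Fw]|w [c Fw]|w Vw].
- split=> [|a u v [c Fu] [c' Fv]]; first by exists 0%N; exact: (subsp0 (F_sub _)).
  by exists (maxn c c'); apply: filt_lin; [apply: filt_mono Fu => //; exact: leq_maxl
    |apply: filt_mono Fv => //; exact: leq_maxr].
- exists c.+1; case: a.
  + exact/FS/F_e.
  + exact: F_h_all.
  + exact/FS/F_p.
  + exact: F_q_all.
  + exact/FS/F_z.
- by exists c; exact: F_k.
- by exists 0%N; exact/filt_base/V0_epV.
Qed.

Let N1_h c m w : m < 0 -> N1 c w -> N1 c.+1 (g gen_h m w).
Proof.
case: c => [|c] hm; last exact: F_h.
by move=> ->; rewrite linear0; exact: (subsp0 (F_sub _)).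
Qed.

Let N1_q c m w : m < d3 -> N1 c w -> N1 c.+1 (g gen_q m w).
Proof.
case: c => [|c] hm; last exact: F_q.
by move=> ->; rewrite linear0; exact: (subsp0 (F_sub _)).
Qed.

(** For m > l the operator p_m kills [epV], and its brackets with h and q again
    preserve the filtration, so that p_m lowers it by one. *)
Lemma F_p_low c m w : l < m -> F c w -> N1 c (g gen_p m w).
Proof.
move=> hm Fw; move: c w Fw m hm.
apply: F_gen_ind => [c|c w Ew m hm|c n w Fw Qw hn m hm|c n w Fw Qw hn m hm].
- split=> [m _|a u v Qu Qv m hm]; first by rewrite linear0; exact: (subsp0 (N1_sub _)).
  by rewrite linearP; apply: (subspZD (N1_sub _)); [exact: Qu|exact: Qv].
- by rewrite epV_p0 //; exact: (subsp0 (N1_sub _)).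
- by rewrite ph; apply: (subspB (F_sub c)); [exact/N1_h/Qw|exact: F_p].
- by rewrite pq; apply: (subspD (F_sub c)); [exact/N1_q/Qw|exact: F_z].
Qed.

Lemma F_e_low c m w : l - d3 < m -> F c w -> N1 c (g gen_e m w).
Proof.
move=> hm Fw; move: c w Fw m hm.
apply: F_gen_ind => [c|c w Ew m hm|c n w Fw Qw hn m hm|c n w Fw Qw hn m hm].
- split=> [m _|a u v Qu Qv m hm]; first by rewrite linear0; exact: (subsp0 (N1_sub _)).
  by rewrite linearP; apply: (subspZD (N1_sub _)); [exact: Qu|exact: Qv].
- by rewrite epV_e0 //; exact: (subsp0 (N1_sub _)).
- rewrite eh; apply: (subspB (F_sub c)); first exact/N1_h/Qw.
  by apply: (subspZ (F_sub c)); exact: F_e.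
- by rewrite eq_; apply: (subspD (F_sub c)); [exact/N1_q/Qw|exact: F_p].
Qed.

Lemma hq_tower_F J c w : T1 J c w -> F c w.
Proof.
apply: (tower_filt (x := hq_gen) epV_sub) => -[|c'] u; first exact: filt_base.
exact: FS.
Qed.

Lemma hq_low_comm J w : hq_low J (hq_gen J w) = hq_gen J (hq_low J w) + P w.
Proof.
rewrite /P /hq_low /hq_gen; case: ifP => _.
  rewrite !negE ph linearN opprB addrC.
  by congr (_ + g _ _ w); lia.
by rewrite eq_; congr (_ + g _ _ w); lia.
Qed.

Lemma hq_low_epV J w : epV w -> hq_low J w = 0.
Proof.
move=> Ew; rewrite /hq_low; case: ifP => _.
  rewrite negE epV_p0 ?oppr0 //; lia.
rewrite epV_e0 //; lia.
Qed.

Lemma hq_low_F J c w : F c w -> N1 c (hq_low J w).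
Proof.
move=> Fw; rewrite /hq_low; case: ifP => _.
  rewrite negE; apply: (subspN (N1_sub _)); apply: F_p_low => //; lia.
apply: F_e_low => //; lia.
Qed.

Let N1_gen J c w : N1 c w -> N1 c.+1 (hq_gen J w).
Proof.
by rewrite /hq_gen; case: ifP => _; [apply: N1_h|apply: N1_q]; lia.
Qed.

(** Here the filtration drops by two: one factor is lost to the bracket with an
    earlier variable, and this bracket lowers the filtration once more
    (or is a vanishing z_m). *)
Lemma hq_low_kill J c w : T1 J c.+1 w -> N1 c (hq_low J w).
Proof.
apply: (tower_kill (N := N1)) => [//|//|u|c' u|J' c' u J'J].
- exact: hq_low_epV.
- exact: hq_low_F.
move/hq_tower_F => Fu.
have := odd_halfE J; have := odd_halfE J'; move: J'J.
rewrite /hq_low /hq_gen.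
case: (odd J); case: (odd J') => J'J J'E JE.
- rewrite !negE ph linearN opprB opprK addrNK.
  apply: F_p_low => //; lia.
- rewrite !negE pq linearN opprD opprK addrAC addNr add0r z0 ?oppr0; last lia.
  exact: (subsp0 (N1_sub _)).
- rewrite eh addrAC subrr add0r; apply/(subspN (N1_sub _))/(subspZ (N1_sub _)).
  apply: F_e_low => //; lia.
- rewrite eq_ addrAC subrr add0r; apply: F_p_low => //; lia.
Qed.

Lemma hq_lowering : lowering hq_gen hq_low P N1 V1.
Proof.
split=> //.
- by move=> [|c]; [exact: epV_sub|exact: F_sub].
- by move=> [|c] w //= ->; exact: (subsp0 epV_sub).
- by move=> J c w; exact: hq_low_F.
- by move=> [|c] w; [exact: epV_p|exact: F_p].
- by move=> [|c] w //; exact: epV_p_inj.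
- exact: hq_low_comm.
- exact: hq_low_epV.
- exact: hq_low_kill.
- move=> J c w /hq_tower_F Fw; rewrite /P /hq_gen; case: ifP => _.
    rewrite ph addrAC subrr add0r; apply: (subspN (F_sub c)); exact: F_p.
  rewrite pq addrAC subrr add0r; exact: F_z.
- move=> J c w _; rewrite /P /hq_low; case: ifP => _.
    by rewrite !negE linearN pp subrr; exact: (subsp0 (N1_sub _)).
  by rewrite ep subrr; exact: (subsp0 (N1_sub _)).
Qed.

Lemma F_tower c w : F c w -> exists J, T1 J c w.
Proof.
have low := hq_lowering.
apply: (filt_tower (N := N1)) => //.
- exact: low_T0_sub low.
- exact: low_NT0 low.
- by move=> [|c'] u; [|exact: filt_base].
- move=> I J c' u /hq_tower_F Fu; rewrite /N1 /hq_gen.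
  do 2![case: ifP => _].
  + rewrite hh addrAC subrr add0r; apply: (subspZ (F_sub _)).
    exact/FS/F_k.
  + by rewrite hq addrAC subrr add0r; apply: (subspN (F_sub _)); exact: F_q_all.
  + by rewrite qh addrAC subrr add0r; exact: F_q_all.
  + by rewrite qq subrr; exact: (subsp0 (F_sub _)).
Qed.

(** A nonzero vector is first stripped of the factors h and q, then of the
    factors e and p. *)
Lemma submodule_meets (U : W -> Prop) : is_subspace U ->
  (forall a m w, U w -> U (g a m w)) ->
  forall w, U w -> w <> 0 -> exists u, [/\ V0 u, U u & u <> 0].
Proof.
move=> U_sub U_g w Uw w0; have [c /F_tower[J Tw]] := F_exhaust w.
have [|c' u|u [Eu Uu u0]] := tower_descent nat_neq0 hq_lowering U_sub _ _ Tw Uw w0.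
- move=> J' u Uu; rewrite /hq_low; case: ifP => _; last exact: U_g.
  by rewrite negE; apply: (subspN U_sub); exact: U_g.
- exact: F_tower.
- exact: epV_descent U_sub U_g u Eu Uu u0.
Qed.

End Stages.

(** * Restrictedness and simplicity of the induced module *)

Section RestrictedGenerated.
Variables (K : fieldType) (W : lieModType (affage K)).

Definition eventually_zero (w : W) : Prop :=
  exists N : int, forall a m, N <= m -> lact (affage_gen K a m) w = 0.

Lemma eventually_zero_sub : is_subspace eventually_zero.
Proof.
split=> [|c u v [N Nu] [N' Nv]]; first by exists 0 => a m _; rewrite linear0.
exists (Num.max N N') => a m; rewrite ge_max => /andP[mN mN'].
by rewrite linearP /= Nu // Nv // scaler0 addr0.
Qed.

(** Since a_m (b_n w) = b_n (a_m w) + [a, b]_(m+n) w once m + n > 0, a vector is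
    killed by all a_m with m large as soon as this holds for a vector generating
    it. *)
Lemma eventually_zero_act (x : affage K) w :
  eventually_zero w -> eventually_zero (lact x w).
Proof.
move=> [N Nw]; elim/affage_ind: x => [|c i x IH].
  by rewrite lact0l; exact: (subsp0 eventually_zero_sub).
rewrite lact_linearl; apply: (subspZD eventually_zero_sub) => //.
case: i => [[b n]|]; last first.
  exists N => a m Nm.
  by rewrite -[affage_basis K _]/(affage_k K) lact_comm Nw // linear0
    [lie _ _]affage_kr lact0l addr0.
have loopE (y : age K) m : N <= m -> lact (affage_loop m y) w = 0.
  move=> Nm; elim/age_ind: y => [|d a y IHy]; first by rewrite linear0 lact0l.
  by rewrite linearP /= lact_linearl affage_loop_gen Nw // IHy scaler0 addr0.
exists (Num.max N (Num.max (N - n) (1 - n))) => a m; rewrite !ge_max.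
move=> /and3P[Nm mn mn1]; rewrite -[affage_basis K _]/(affage_gen K b n).
rewrite lact_comm Nw // linear0 add0r lie_gen lactDl lactZl loopE; last by lia.
have -> : (m + n == 0) = false by apply/eqP; lia.
by rewrite mulr0 scale0r addr0.
Qed.
End RestrictedGenerated.

Section AgeMain.
Variables (K : fieldType) (d1 d2 d3 l : int) (hd : d2 <= d1 + d3).
Hypothesis nat_neq0 : forall n, n.+1%:R != 0 :> K.
Variable V : lieModType (affage_sub K hd).
Hypothesis V_simple : simple_module V.
Hypotheses (hl : d2 < l) (hl_mem : d1 + d3 <= l + 1).
Hypothesis p_inj : acts_injectively V (affage_gen K gen_p l).
Hypothesis vanish : forall i : int, 0 < i ->
  [/\ acts_by_zero V (affage_gen K gen_p (l + i)),
      acts_by_zero V (affage_gen K gen_z (l + d2 - d1 + i - 1)),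
      acts_by_zero V (affage_gen K gen_e (l - d3 + i)),
      acts_by_zero V (affage_gen K gen_q (l - d1 + i)) &
      acts_by_zero V (affage_gen K gen_h (l - d2 + i))].

Let V0 (w : induced V) : Prop := exists v, w = ind_unit v.

Lemma unit_zero x w : acts_by_zero V x -> V0 w -> lact x w = 0.
Proof.
move=> [y <- y0] [v ->]; rewrite ind_unit_act y0.
exact: linear_0 (@ind_unit_linear _ _ _ _ V).
Qed.

Let p0 m w : l < m -> V0 w -> lact (affage_gen K gen_p m) w = 0.
Proof.
move=> hm; apply: unit_zero; have [|+ _ _ _ _] := vanish (i := m - l); first by lia.
by have -> : l + (m - l) = m by lia.
Qed.
Let z0 m w : l + d2 - d1 <= m -> V0 w -> lact (affage_gen K gen_z m) w = 0.
Proof.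
move=> hm; apply: unit_zero.
have [|_ + _ _ _] := vanish (i := m - (l + d2 - d1) + 1); first by lia.
by have -> : l + d2 - d1 + (m - (l + d2 - d1) + 1) - 1 = m by lia.
Qed.
Let e0 m w : l - d3 < m -> V0 w -> lact (affage_gen K gen_e m) w = 0.
Proof.
move=> hm; apply: unit_zero.
have [|_ _ + _ _] := vanish (i := m - (l - d3)); first by lia.
by have -> : l - d3 + (m - (l - d3)) = m by lia.
Qed.
Let q0 m w : l - d1 < m -> V0 w -> lact (affage_gen K gen_q m) w = 0.
Proof.
move=> hm; apply: unit_zero.
have [|_ _ _ + _] := vanish (i := m - (l - d1)); first by lia.
by have -> : l - d1 + (m - (l - d1)) = m by lia.
Qed.
Let h0 m w : l - d2 < m -> V0 w -> lact (affage_gen K gen_h m) w = 0.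
Proof.
move=> hm; apply: unit_zero.
have [|_ _ _ _ +] := vanish (i := m - (l - d2)); first by lia.
by have -> : l - d2 + (m - (l - d2)) = m by lia.
Qed.

Lemma induced_restricted : restricted (induced V).
Proof.
apply: induced_gen; first exact: eventually_zero_sub.
  exact: eventually_zero_act.
move=> v; have Vv : V0 (ind_unit v) by exists v.
exists (`|l| + `|d1| + `|d2| + `|d3| + `|l + d2 - d1| + 1) => a m hm.
by case: a; [apply: e0|apply: h0|apply: p0|apply: q0|apply: z0] => //; lia.
Qed.

(** The vectors v with 1 (x) v in a nonzero submodule form a submodule of V, nonzero by
    [submodule_meets], hence equal to V, which generates the induced module. *)
Lemma induced_simple : simple_module (induced V).
Proof.
have [[v0 v0N0] V_sub] := V_simple.
have unit_lin := @ind_unit_linear _ _ _ _ V.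
have unit0 := linear_0 unit_lin.
have V0_sub : is_subspace V0.
  split=> [|c _ _ [u ->] [v ->]]; first by exists 0.
  by exists (c *: u + v); rewrite unit_lin.
have V0_basis i w : age_sub_index d1 d2 d3 i -> V0 w -> V0 (lact (affage_basis K i) w).
  rewrite -(age_sub_basis K) => iS [v ->].
  pose y := Sub (affage_basis K i) iS : affage_sub K hd.
  by exists (lact y v); rewrite -ind_unit_act.
have V0_gen (Q : induced V -> Prop) : is_subspace Q ->
    (forall a m w, Q w -> Q (lact (affage_gen K a m) w)) ->
    (forall w, Q w -> Q (lact (affage_k K) w)) ->
    (forall w, V0 w -> Q w) -> forall w, Q w.
  move=> Q_sub Qg Qk QV; apply: induced_gen => // [x w Qw|v]; last first.
    by apply: QV; exists v.
  elim/affage_ind: x => [|c i x IH]; first by rewrite lact0l; exact: (subsp0 Q_sub).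
  rewrite lact_linearl; apply: (subspZD Q_sub) => //.
  by case: i => [[a m]|]; [exact: Qg|exact: Qk].
have V0_p_inj w : V0 w -> lact (affage_gen K gen_p l) w = 0 -> w = 0.
  have [y yE y_inj] := p_inj; move=> [v ->].
  rewrite -yE ind_unit_act => /induced_unit_inj yv0.
  have -> : v = 0 by apply: y_inj; rewrite yv0 linear0.
  exact: unit0.
split=> [|U [U_sub U_act]].
  by exists (ind_unit v0) => /induced_unit_inj.
have [[w [Uw w0]]|U0] := pselect (exists w, U w /\ w <> 0); last first.
  by left=> w Uw; apply: contrapT => w0; apply: U0; exists w.
right.
have [u [[v uE] Uu u0]] : exists u, [/\ V0 u, U u & u <> 0].
  apply: (submodule_meets nat_neq0 hd hl hl_mem (affage_rep (induced V))
    V0_sub _ _ V0_gen V0_p_inj p0 z0 e0 q0 h0 U_sub _ Uw w0) => [a m|u|a m u].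
  - exact: (V0_basis (Some (a, m))).
  - exact: (V0_basis None).
  - exact: U_act.
pose U' v := U (ind_unit v).
have [U'0|U'T] : (forall v, U' v -> v = 0) \/ (forall v, U' v).
  apply: V_sub; split=> [|y v' Uv'].
    split=> [|c v1 v2 U1 U2]; first by rewrite /U' unit0; exact: (subsp0 U_sub).
    by rewrite /U' unit_lin; exact: (subspZD U_sub).
  by rewrite /U' -ind_unit_act; exact: U_act.
- by case: u0; rewrite uE (U'0 v) ?unit0 // /U' -uE.
- exact: induced_gen.
Qed.
End AgeMain.

Theorem theorem4p2 (R : realType) (d1 d2 d3 : int) (hd : d2 <= d1 + d3)
    (V : lieModType (affage_sub R[i] hd)) (V_simple : simple_module V)
    (l : int) (hl : d2 < l) (hl_mem : d1 + d3 <= l + 1)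
    (p_inj : acts_injectively V (affage_gen R[i] gen_p l))
    (vanish : forall i : int, 0 < i ->
      [/\ acts_by_zero V (affage_gen R[i] gen_p (l + i)),
          acts_by_zero V (affage_gen R[i] gen_z (l + d2 - d1 + i - 1)),
          acts_by_zero V (affage_gen R[i] gen_e (l - d3 + i)),
          acts_by_zero V (affage_gen R[i] gen_q (l - d1 + i)) &
          acts_by_zero V (affage_gen R[i] gen_h (l - d2 + i))]) :
  simple_module (induced V) /\ restricted (induced V).
Proof.
split; last exact: induced_restricted vanish.
apply: (induced_simple _ V_simple hl hl_mem p_inj vanish) => n.
by rewrite pnatr_eq0.
Qed.
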